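(* Let $\alpha_1,\alpha_2>0$ satisfy $2(\alpha_1-\alpha_2)\ge \pi e$. Let $p$ be analytic in $\mathbb{D}$ with $p(0)=1$. If $$1+\alpha_1 zp'(z)+\alpha_2 z^2p''(z)\prec 1+\sinh^{-1} z,$$ then $p(z)\prec e^z$.
   Context: $\mathbb{D}$ is the open unit disk. For $g,h$ analytic in $\mathbb{D}$, $g\prec h$ means there is an analytic $w:\mathbb{D}\to\mathbb{D}$ with $w(0)=0$ and $g=h\circ w$. $\sinh^{-1}z$ denotes the branch of the inverse hyperbolic sine analytic in $\mathbb{D}$ with $\sinh^{-1}0=0$. *)

(* Defs.v *)
From Stdlib Require Import Reals.
From Coquelicot Require Import Coquelicot.
Open Scope R_scope.

Definition inD (z : C) : Prop := Cmod z < 1.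

Definition analytic_D (f : C -> C) : Prop :=
  forall z, inD z -> @ex_derive C_AbsRing C_NormedModule f z.

Definition Cexp (z : C) : C :=
  (RtoC (exp (Re z)) * (RtoC (cos (Im z)) + Ci * RtoC (sin (Im z))))%C.
Definition Csinh (z : C) : C := ((Cexp z - Cexp (- z)) / RtoC 2)%C.

Definition is_asinh_D (h : C -> C) : Prop :=
  analytic_D h /\ h (RtoC 0) = RtoC 0 /\ (forall z, inD z -> Csinh (h z) = z).

Definition subord (g h : C -> C) : Prop :=
  exists w : C -> C, analytic_D w /\ (forall z, inD z -> inD (w z)) /\
    w (RtoC 0) = RtoC 0 /\ (forall z, inD z -> g z = h (w z)).

(* Main.v *)
Require Import Defs.
From Stdlib Require Import Reals Ranalysis5 Lra.
From Coquelicot Require Import Coquelicot.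
Open Scope R_scope.

(** Put [chi z = a1 p'(z) + a2 z p''(z)].  By hypothesis [z chi(z) = asinh (w z)], and
    [|asinh| <= PI/2] on the disc, so the maximum modulus principle gives [|chi| <= PI/2].
    At a point of a radius where [|p'|] is maximal, [Re (conj (p') z p'') >= 0], hence
    [a1 |p'| <= |chi| <= PI/2] and [|p'| <= PI / (2 a1) < 1/e < 1/2].  Thus
    [|p - 1| < 1/2], the logarithmic derivative [p'/p] is bounded by [1], and the primitive
    [W] of [p'/p] vanishing at [0] satisfies [|W z| <= |z|] and [p = e^W].

    That [p'] is again analytic needs Cauchy's theory: Goursat's lemma gives primitives on
    the disc, and Cauchy's formula for a primitive [F] of [p] shows that [F], hence [p],
    is infinitely differentiable. *)

(** [analytic_D] only asks for a complex derivative at each point, so nothing is known in advance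
    about the continuity of that derivative; this is why Goursat's lemma has to come from the
    subdivision of triangles and not from Green's formula. Cauchy's formula is obtained first for
    functions whose derivative is itself analytic. A primitive of an analytic function is of that
    kind, and this breaks the apparent circle between Cauchy's formula and the analyticity of the
    derivative.

    The bound on [chi] is an instance of Schwarz's lemma: [z chi z] is divided by [z] on circles of
    radius close to 1. The maximum of [|p'|] is taken along the radius from 0 to [z], endpoint
    included, where a derivative from the left already has a sign; hence the behaviour near the unit
    circle never enters. The Schwarz function that the subordination asks for is a logarithm of [p],
    and a bound by 1 on its derivative is exactly what makes it map the disc into itself. *)

Notation Cderiv := (@is_derive C_AbsRing C_NormedModule).

(** * Complex modulus and complex differentiation *)

Lemma Cmod_triangle_sub (a b : C) : Cmod (a - b) <= Cmod a + Cmod b.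
Proof.
  unfold Cminus. rewrite <- (Cmod_opp b). apply Cmod_triangle.
Qed.

Lemma Cmod_sub_ge (a b : C) : Cmod a - Cmod b <= Cmod (a - b).
Proof.
  pose proof (Cmod_triangle (a - b) b) as H.
  replace (a - b + b)%C with a in H by ring. lra.
Qed.

Lemma Cmod_sub_sym (a b : C) : Cmod (a - b) = Cmod (b - a).
Proof.
  rewrite <- Cmod_opp. f_equal. ring.
Qed.

(** The filter definition is unfolded once into an estimate without division, in which [h = 0] is
    harmless; later estimates start from this form. *)
Lemma Cderiv_eps (f : C -> C) (z l : C) :
  Cderiv f z l <->
  forall eps, 0 < eps -> exists d, 0 < d /\ forall h, Cmod h < d ->
    Cmod (f (z + h) - f z - l * h)%C <= eps * Cmod h.
Proof.
  split.
  - intros [_ H] eps He.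
    destruct (H z (fun P HP => HP) (mkposreal eps He)) as [d Hd].
    exists d; split; [apply cond_pos|]. intros h Hh.
    specialize (Hd (z + h)%C).
    assert (B : @ball (AbsRing_UniformSpace C_AbsRing) z d (z + h)%C).
    { change (Cmod (z + h - z)%C < d).
      replace (z + h - z)%C with h by ring. exact Hh. }
    specialize (Hd B).
    change (Cmod (f (z + h) - f z - (z + h - z) * l)%C
            <= eps * Cmod (z + h - z)%C) in Hd.
    replace (z + h - z)%C with h in Hd by ring.
    rewrite (Cmult_comm l h). exact Hd.
  - intros H. split.
    + apply (@is_linear_scal_l C_AbsRing C_NormedModule l).
    + intros x Hx eps.
      rewrite <- (is_filter_lim_locally_unique _ _ Hx).
      destruct (H eps (cond_pos eps)) as (d & Hd & Hf).
      exists (mkposreal d Hd).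
      change (forall y : C, Cmod (y - z)%C < d ->
        Cmod (f y - f z - (y - z) * l)%C <= eps * Cmod (y - z)%C). intros y Hy.
      specialize (Hf (y - z)%C Hy).
      replace (z + (y - z))%C with y in Hf by ring.
      rewrite (Cmult_comm (y - z) l). exact Hf.
Qed.

(** The two module structures on [C] have convertible operations and norms, so only the linearity
    record has to be rebuilt. The product rule and the inner function of the chain rule live in the
    second structure. *)
Lemma Cderiv_AbsRing (f : C -> C) (z l : C) :
  Cderiv f z l <-> @is_derive C_AbsRing (AbsRing_NormedModule C_AbsRing) f z l.
Proof.
  split; (intros [[H1 H2 H3] H]; split; [constructor; assumption | exact H]).
Qed.

Lemma Cderiv_const (a z : C) : Cderiv (fun _ => a) z (RtoC 0).
Proof. apply (@is_derive_const C_AbsRing C_NormedModule). Qed.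

Lemma Cderiv_id (z : C) : Cderiv (fun x => x) z (RtoC 1).
Proof. apply Cderiv_AbsRing, (@is_derive_id C_AbsRing). Qed.

Lemma Cderiv_plus (f g : C -> C) (z a b : C) :
  Cderiv f z a -> Cderiv g z b -> Cderiv (fun x => f x + g x)%C z (a + b)%C.
Proof. apply (@is_derive_plus C_AbsRing C_NormedModule). Qed.

Lemma Cderiv_minus (f g : C -> C) (z a b : C) :
  Cderiv f z a -> Cderiv g z b -> Cderiv (fun x => f x - g x)%C z (a - b)%C.
Proof. apply (@is_derive_minus C_AbsRing C_NormedModule). Qed.

Lemma Cderiv_mult (f g : C -> C) (z a b : C) :
  Cderiv f z a -> Cderiv g z b ->
  Cderiv (fun x => f x * g x)%C z (a * g z + f z * b)%C.
Proof.
  intros Hf Hg. apply (proj2 (Cderiv_AbsRing _ _ _)).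
  apply (proj1 (Cderiv_AbsRing _ _ _)) in Hf, Hg.
  pose proof (@filterdiff_mult_fct C_AbsRing (AbsRing_NormedModule C_AbsRing) f g z
                  (fun y => y * a)%C (fun y => y * b)%C Cmult_comm Hf Hg) as H.
  eapply filterdiff_ext_lin. exact H.
  intros y. change ((y * a) * g z + f z * (y * b) = y * (a * g z + f z * b))%C.
  ring.
Qed.

Lemma Cderiv_comp (f g : C -> C) (z a b : C) :
  Cderiv f (g z) a -> Cderiv g z b -> Cderiv (fun x => f (g x)) z (b * a)%C.
Proof.
  intros Hf Hg. apply (proj1 (Cderiv_AbsRing _ _ _)) in Hg.
  exact (is_derive_comp (K := C_AbsRing) (V := C_NormedModule) f g z a b Hf Hg).
Qed.

Lemma Cderiv_ext_ball (f g : C -> C) (z l : C) (d : R) :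
  0 < d -> (forall h, Cmod h < d -> f (z + h)%C = g (z + h)%C) ->
  Cderiv f z l -> Cderiv g z l.
Proof.
  intros Hd E H. rewrite Cderiv_eps in H |- *. intros eps He.
  destruct (H eps He) as (d1 & Hd1 & Hf).
  exists (Rmin d d1); split; [apply Rmin_pos; assumption|].
  intros h Hh.
  rewrite <- E by (eapply Rlt_le_trans; [exact Hh | apply Rmin_l]).
  replace (g z) with (f z).
  - apply Hf. eapply Rlt_le_trans; [exact Hh | apply Rmin_r].
  - replace z with (z + 0)%C at 1 2 by ring. apply E. rewrite Cmod_0. exact Hd.
Qed.

Lemma Cderiv_inv_id (z : C) : z <> 0 -> Cderiv Cinv z (- / (z * z))%C.
Proof.
  intros Hz. apply Cderiv_eps. intros eps He.
  assert (Hm : 0 < Cmod z) by (apply Cmod_gt_0; exact Hz).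
  set (m := Cmod z) in *.
  assert (Hm3 : 0 < m * m * m) by (repeat apply Rmult_lt_0_compat; assumption).
  (* The error is exactly [h^2 / (z^2 (z + h))]. The first bound keeps [|z + h| >= m / 2], the
     second then absorbs one factor [|h|] into [eps]. *)
  exists (Rmin (m / 2) (eps * (m * m * m) / 2)); split.
  { apply Rmin_pos; [lra|]. assert (0 < eps * (m * m * m)) by
      (apply Rmult_lt_0_compat; assumption). lra. }
  intros h Hh.
  assert (H1 : Cmod h < m / 2) by (eapply Rlt_le_trans; [exact Hh | apply Rmin_l]).
  assert (H2 : Cmod h < eps * (m * m * m) / 2)
    by (eapply Rlt_le_trans; [exact Hh | apply Rmin_r]).
  assert (Hb : m / 2 <= Cmod (z + h)).
  { pose proof (Cmod_sub_ge z (- h)) as T. rewrite Cmod_opp in T.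
    replace (z - - h)%C with (z + h)%C in T by ring. fold m in T. lra. }
  assert (Hzh : (z + h)%C <> 0) by (apply Cmod_gt_0; lra).
  replace (/ (z + h) - / z - - / (z * z) * h)%C
    with (h * h / (z * z * (z + h)))%C by (field; split; assumption).
  assert (Hp : (z * z * (z + h))%C <> 0)
    by (repeat apply Cmult_neq_0; assumption).
  rewrite Cmod_div, !Cmod_mult by exact Hp. fold m.
  assert (P : 0 < m * m * Cmod (z + h)) by
    (repeat apply Rmult_lt_0_compat; lra).
  apply Rle_div_l; [exact P|].
  pose proof (Cmod_ge_0 h).
  assert (Cmod h <= eps * (m * m * Cmod (z + h))).
  { apply Rle_trans with (eps * (m * m * (m / 2))); [lra|].
    apply Rmult_le_compat_l; [lra|]. apply Rmult_le_compat_l; [nra|lra]. }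
  replace (eps * Cmod h * (m * m * Cmod (z + h)))
    with (Cmod h * (eps * (m * m * Cmod (z + h)))) by ring.
  apply Rmult_le_compat_l; assumption.
Qed.

Lemma Cderiv_inv (f : C -> C) (z a : C) :
  f z <> 0 -> Cderiv f z a -> Cderiv (fun x => / f x)%C z (- a / (f z * f z))%C.
Proof.
  intros Hz Hf.
  replace (- a / (f z * f z))%C with (a * (- / (f z * f z)))%C by (field; exact Hz).
  apply (Cderiv_comp Cinv f); [apply Cderiv_inv_id; exact Hz | exact Hf].
Qed.

Lemma Cderiv_eq (f : C -> C) (z a b : C) : Cderiv f z a -> a = b -> Cderiv f z b.
Proof. intros H <-. exact H. Qed.

Definition Ccont (f : C -> C) (z : C) : Prop :=
  forall eps, 0 < eps -> exists d, 0 < d /\ forall h, Cmod h < d ->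
    Cmod (f (z + h) - f z)%C < eps.

Lemma Cderiv_cont (f : C -> C) (z l : C) : Cderiv f z l -> Ccont f z.
Proof.
  intros H eps He. rewrite Cderiv_eps in H. destruct (H 1 Rlt_0_1) as (d & Hd & Hf).
  pose proof (Cmod_ge_0 l).
  assert (Hq : 0 < eps / (Cmod l + 2)) by (apply Rdiv_lt_0_compat; lra).
  exists (Rmin d (eps / (Cmod l + 2))); split; [apply Rmin_pos; assumption|].
  intros h Hh.
  assert (H1 : Cmod h < d) by (eapply Rlt_le_trans; [exact Hh | apply Rmin_l]).
  assert (H2 : Cmod h < eps / (Cmod l + 2))
    by (eapply Rlt_le_trans; [exact Hh | apply Rmin_r]).
  specialize (Hf h H1).
  pose proof (Cmod_triangle (f (z + h)%C - f z - l * h)%C (l * h)%C) as T.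
  replace (f (z + h)%C - f z - l * h + l * h)%C with (f (z + h)%C - f z)%C in T by ring.
  rewrite Cmod_mult in T. pose proof (Cmod_ge_0 h).
  apply Rlt_div_r in H2; [|lra]. nra.
Qed.

(** * Curves *)

(** Componentwise, so that the real mean value theorem and the real integral apply directly;
    [Kderiv_eps] recovers the estimate in the modulus. *)
Definition Kderiv (c : R -> C) (t : R) (l : C) : Prop :=
  is_derive (fun s => fst (c s)) t (fst l) /\ is_derive (fun s => snd (c s)) t (snd l).

Definition Kcont (c : R -> C) (t : R) : Prop :=
  continuous (fun s => fst (c s)) t /\ continuous (fun s => snd (c s)) t.

Lemma Cmod_le_sum (z : C) : Cmod z <= Rabs (fst z) + Rabs (snd z).
Proof.
  replace z with (RtoC (fst z) + Ci * RtoC (snd z))%C at 1.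
  - eapply Rle_trans; [apply Cmod_triangle|].
    rewrite Cmod_mult, Cmod_Ci, !Cmod_R. lra.
  - destruct z; unfold RtoC, Ci, Cplus, Cmult; simpl. f_equal; ring.
Qed.

Lemma fst_le_Cmod (z : C) : Rabs (fst z) <= Cmod z.
Proof. eapply Rle_trans; [apply Rmax_l | apply Rmax_Cmod]. Qed.

Lemma snd_le_Cmod (z : C) : Rabs (snd z) <= Cmod z.
Proof. eapply Rle_trans; [apply Rmax_r | apply Rmax_Cmod]. Qed.

Lemma is_derive_R_eps (f : R -> R) (t l : R) :
  is_derive f t l <->
  forall eps, 0 < eps -> exists d, 0 < d /\ forall h, Rabs h < d ->
    Rabs (f (t + h) - f t - l * h) <= eps * Rabs h.
Proof.
  split.
  - intros [_ H] eps He.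
    destruct (H t (fun P HP => HP) (mkposreal eps He)) as [d Hd].
    exists d; split; [apply cond_pos|]. intros h Hh.
    specialize (Hd (t + h)).
    assert (B : ball t d (t + h)).
    { change (Rabs (t + h - t) < d). replace (t + h - t) with h by ring. exact Hh. }
    specialize (Hd B).
    change (Rabs (f (t + h) - f t - (t + h - t) * l) <= eps * Rabs (t + h - t)) in Hd.
    replace (t + h - t) with h in Hd by ring.
    rewrite (Rmult_comm l h). exact Hd.
  - intros H. split.
    + apply (@is_linear_scal_l R_AbsRing R_NormedModule l).
    + intros x Hx eps.
      rewrite <- (is_filter_lim_locally_unique _ _ Hx).
      destruct (H eps (cond_pos eps)) as (d & Hd & Hf).
      exists (mkposreal d Hd).
      change (forall y : R, Rabs (y - t) < d ->
        Rabs (f y - f t - (y - t) * l) <= eps * Rabs (y - t)). intros y Hy.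
      specialize (Hf (y - t) Hy).
      replace (t + (y - t)) with y in Hf by ring.
      rewrite (Rmult_comm (y - t) l). exact Hf.
Qed.

Lemma Kderiv_eps (c : R -> C) (t : R) (l : C) :
  Kderiv c t l <->
  forall eps, 0 < eps -> exists d, 0 < d /\ forall h, Rabs h < d ->
    Cmod (c (t + h)%R - c t - l * RtoC h)%C <= eps * Rabs h.
Proof.
  assert (E1 : forall h, fst (c (t + h)%R - c t - l * RtoC h)%C
                    = fst (c (t + h)) - fst (c t) - fst l * h)
    by (intros; unfold RtoC; simpl; ring).
  assert (E2 : forall h, snd (c (t + h)%R - c t - l * RtoC h)%C
                    = snd (c (t + h)) - snd (c t) - snd l * h)
    by (intros; unfold RtoC; simpl; ring).
  unfold Kderiv. rewrite !is_derive_R_eps. split.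
  - intros [H1 H2] eps He.
    destruct (H1 (eps / 2)) as (d1 & Hd1 & F1); [lra|].
    destruct (H2 (eps / 2)) as (d2 & Hd2 & F2); [lra|].
    exists (Rmin d1 d2); split; [apply Rmin_pos; assumption|].
    intros h Hh. eapply Rle_trans; [apply Cmod_le_sum|]. rewrite E1, E2.
    pose proof (F1 h (Rlt_le_trans _ _ _ Hh (Rmin_l _ _))).
    pose proof (F2 h (Rlt_le_trans _ _ _ Hh (Rmin_r _ _))). lra.
  - intros H; split; intros eps He; destruct (H eps He) as (d & Hd & F);
      exists d; (split; [exact Hd|]); intros h Hh;
      eapply Rle_trans; [|apply F, Hh| |apply F, Hh].
    + rewrite <- E1. apply fst_le_Cmod.
    + rewrite <- E2. apply snd_le_Cmod.
Qed.

Lemma continuous_R_eps (f : R -> R) (t : R) :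
  continuous f t <->
  forall eps, 0 < eps -> exists d, 0 < d /\ forall h, Rabs h < d ->
    Rabs (f (t + h) - f t) < eps.
Proof.
  split.
  - intros H eps He.
    destruct (proj1 (filterlim_locally f (f t)) H (mkposreal eps He)) as [d Hd].
    exists d; split; [apply cond_pos|]. intros h Hh. apply (Hd (t + h)).
    change (Rabs (t + h - t) < d). replace (t + h - t) with h by ring. exact Hh.
  - intros H. apply filterlim_locally. intros eps.
    destruct (H eps (cond_pos eps)) as (d & Hd & F).
    exists (mkposreal d Hd).
    change (forall y : R, Rabs (y - t) < d -> Rabs (f y - f t) < eps). intros y Hy.
    replace y with (t + (y - t)) by ring. apply F, Hy.
Qed.

Lemma Kcont_eps (c : R -> C) (t : R) :
  Kcont c t <->
  forall eps, 0 < eps -> exists d, 0 < d /\ forall h, Rabs h < d ->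
    Cmod (c (t + h)%R - c t)%C < eps.
Proof.
  unfold Kcont. rewrite !continuous_R_eps. split.
  - intros [H1 H2] eps He.
    destruct (H1 (eps / 2)) as (d1 & Hd1 & F1); [lra|].
    destruct (H2 (eps / 2)) as (d2 & Hd2 & F2); [lra|].
    exists (Rmin d1 d2); split; [apply Rmin_pos; assumption|].
    intros h Hh. eapply Rle_lt_trans; [apply Cmod_le_sum|]. simpl.
    pose proof (F1 h (Rlt_le_trans _ _ _ Hh (Rmin_l _ _))).
    pose proof (F2 h (Rlt_le_trans _ _ _ Hh (Rmin_r _ _))).
    unfold Rminus in *. lra.
  - intros H; split; intros eps He; destruct (H eps He) as (d & Hd & F);
      exists d; (split; [exact Hd|]); intros h Hh;
      (eapply Rle_lt_trans; [|apply F, Hh]).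
    + apply (fst_le_Cmod (c (t + h)%R - c t)%C).
    + apply (snd_le_Cmod (c (t + h)%R - c t)%C).
Qed.

Lemma Kderiv_cont (c : R -> C) (t : R) (l : C) : Kderiv c t l -> Kcont c t.
Proof.
  intros [H1 H2]; split; apply (@ex_derive_continuous R_AbsRing R_NormedModule);
    eexists; eassumption.
Qed.

Lemma Kcont_ext (c e : R -> C) (t : R) : (forall s, c s = e s) -> Kcont c t -> Kcont e t.
Proof.
  intros H [H1 H2]; split.
  - apply (continuous_ext (fun s => fst (c s))); [intros; rewrite H; reflexivity | exact H1].
  - apply (continuous_ext (fun s => snd (c s))); [intros; rewrite H; reflexivity | exact H2].
Qed.

Lemma Kcont_comp (f : C -> C) (c : R -> C) (t : R) :
  Ccont f (c t) -> Kcont c t -> Kcont (fun s => f (c s)) t.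
Proof.
  intros Hf Hc. rewrite Kcont_eps in Hc |- *. intros eps He.
  destruct (Hf eps He) as (d & Hd & F). destruct (Hc d Hd) as (d' & Hd' & G).
  exists d'; split; [exact Hd'|]. intros h Hh. specialize (F _ (G h Hh)).
  replace (c t + (c (t + h)%R - c t))%C with (c (t + h)) in F by ring. exact F.
Qed.

Lemma Kderiv_comp (f : C -> C) (c : R -> C) (t : R) (a b : C) :
  Cderiv f (c t) a -> Kderiv c t b -> Kderiv (fun s => f (c s)) t (a * b)%C.
Proof.
  intros Hf Hc. assert (Hk : Kcont c t) by (eapply Kderiv_cont; exact Hc).
  rewrite Cderiv_eps in Hf. rewrite Kcont_eps in Hk.
  rewrite Kderiv_eps in Hc |- *. intros eps He.
  pose proof (Cmod_ge_0 a) as Ha. pose proof (Cmod_ge_0 b) as Hb.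
  (* The error splits into the remainder of [f] at the increment [D] and [a] times the remainder of
     [c]; each receives [eps / 2]. The cap [e2 <= 1] yields [|D| <= (|b| + 1) |h|]. *)
  set (e1 := eps / 2 / (Cmod b + 1)).
  assert (He1 : 0 < e1) by (unfold e1; apply Rdiv_lt_0_compat; lra).
  set (e2 := Rmin 1 (eps / 2 / (Cmod a + 1))).
  assert (He2 : 0 < e2)
    by (unfold e2; apply Rmin_pos; [lra | apply Rdiv_lt_0_compat; lra]).
  destruct (Hf e1 He1) as (d1 & Hd1 & F).
  destruct (Hk d1 Hd1) as (d2 & Hd2 & G).
  destruct (Hc e2 He2) as (d3 & Hd3 & K).
  exists (Rmin d2 d3); split; [apply Rmin_pos; assumption|]. intros h Hh.
  specialize (G h (Rlt_le_trans _ _ _ Hh (Rmin_l _ _))).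
  specialize (K h (Rlt_le_trans _ _ _ Hh (Rmin_r _ _))).
  specialize (F _ G).
  replace (c t + (c (t + h)%R - c t))%C with (c (t + h)) in F by ring.
  set (D := (c (t + h)%R - c t)%C) in *.
  replace (f (c (t + h)%R) - f (c t) - a * b * RtoC h)%C
    with ((f (c (t + h)%R) - f (c t) - a * D) + a * (D - b * RtoC h))%C by ring.
  eapply Rle_trans; [apply Cmod_triangle|]. rewrite Cmod_mult.
  assert (HD : Cmod D <= (Cmod b + 1) * Rabs h).
  { replace D with ((D - b * RtoC h) + b * RtoC h)%C by ring.
    eapply Rle_trans; [apply Cmod_triangle|]. rewrite Cmod_mult, Cmod_R.
    assert (e2 <= 1) by apply Rmin_l. pose proof (Rabs_pos h). nra. }
  assert (A1 : e1 * Cmod D <= eps / 2 * Rabs h).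
  { replace (eps / 2 * Rabs h) with (e1 * ((Cmod b + 1) * Rabs h))
      by (unfold e1; field; lra).
    apply Rmult_le_compat_l; lra. }
  assert (A2 : Cmod a * Cmod (D - b * RtoC h)%C <= eps / 2 * Rabs h).
  { apply Rle_trans with ((Cmod a + 1) * (e2 * Rabs h)).
    - apply Rmult_le_compat; try lra. apply Cmod_ge_0.
    - replace (eps / 2 * Rabs h)
        with ((Cmod a + 1) * (eps / 2 / (Cmod a + 1) * Rabs h)) by (field; lra).
      apply Rmult_le_compat_l; [lra|]. apply Rmult_le_compat_r; [apply Rabs_pos|].
      apply Rmin_r. }
  lra.
Qed.

Lemma Kderiv_mult (c e : R -> C) (t : R) (a b : C) :
  Kderiv c t a -> Kderiv e t b ->
  Kderiv (fun s => c s * e s)%C t (a * e t + c t * b)%C.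
Proof.
  intros [H1 H2] [H3 H4]; split; simpl.
  - apply (is_derive_ext (fun s => fst (c s) * fst (e s) - snd (c s) * snd (e s)));
      [reflexivity|].
    pose proof (@is_derive_minus _ _ _ _ _ _ _ (is_derive_mult _ _ _ _ _ H1 H3 Rmult_comm)
                  (is_derive_mult _ _ _ _ _ H2 H4 Rmult_comm)) as H.
    refine (eq_ind _ (is_derive _ t) H _ _).
    unfold minus, plus, opp, mult; simpl; ring.
  - pose proof (@is_derive_plus _ _ _ _ _ _ _ (is_derive_mult _ _ _ _ _ H1 H4 Rmult_comm)
                  (is_derive_mult _ _ _ _ _ H2 H3 Rmult_comm)) as H.
    apply (is_derive_ext (fun s => fst (c s) * snd (e s) + snd (c s) * fst (e s)));
      [reflexivity|].
    refine (eq_ind _ (is_derive _ t) H _ _). unfold plus, mult; simpl; ring.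
Qed.

Lemma Kderiv_plus (c e : R -> C) (t : R) (a b : C) :
  Kderiv c t a -> Kderiv e t b -> Kderiv (fun s => c s + e s)%C t (a + b)%C.
Proof.
  intros [H1 H2] [H3 H4]; split; simpl;
    apply (@is_derive_plus R_AbsRing R_NormedModule); assumption.
Qed.

Lemma Kderiv_const (a : C) (t : R) : Kderiv (fun _ => a) t 0.
Proof. split; apply (@is_derive_const R_AbsRing R_NormedModule). Qed.

Lemma Kderiv_RtoC (f : R -> R) (t l : R) :
  is_derive f t l -> Kderiv (fun s => RtoC (f s)) t (RtoC l).
Proof.
  intros H; split; simpl; [exact H | apply (@is_derive_const R_AbsRing R_NormedModule)].
Qed.

Lemma Kderiv_eq (c : R -> C) (t : R) (a b : C) :
  Kderiv c t a -> a = b -> Kderiv c t b.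
Proof. intros H <-. exact H. Qed.

Lemma Kderiv_segment (z h : C) (t : R) : Kderiv (fun s => z + RtoC s * h)%C t h.
Proof.
  eapply Kderiv_eq.
  - apply Kderiv_plus; [apply Kderiv_const|]. apply Kderiv_mult; [|apply Kderiv_const].
    apply (Kderiv_RtoC (fun s => s) t 1), (@is_derive_id R_AbsRing).
  - cbv beta. ring.
Qed.

Lemma Kcont_mult (c e : R -> C) (t : R) :
  Kcont c t -> Kcont e t -> Kcont (fun s => c s * e s)%C t.
Proof.
  intros [H1 H2] [H3 H4]; split; simpl.
  - apply (@continuous_minus R_UniformSpace R_AbsRing R_NormedModule
      (fun s => fst (c s) * fst (e s)) (fun s => snd (c s) * snd (e s)));
    apply (@continuous_mult R_UniformSpace R_AbsRing); assumption.
  - apply (@continuous_plus R_UniformSpace R_AbsRing R_NormedModule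
      (fun s => fst (c s) * snd (e s)) (fun s => snd (c s) * fst (e s)));
    apply (@continuous_mult R_UniformSpace R_AbsRing); assumption.
Qed.

Lemma Kcont_const (a : C) (t : R) : Kcont (fun _ => a) t.
Proof. split; apply continuous_const. Qed.

(* Multiplying by the conjugate direction of a complex number turns its modulus into
   a real part, so real estimates transfer to complex values. *)
Lemma Cmod_as_fst (z : C) : exists u : C, Cmod u <= 1 /\ fst (u * z)%C = Cmod z.
Proof.
  destruct (Req_dec (Cmod z) 0) as [H0|H0].
  - exists 0. rewrite Cmod_0, H0. split; [lra|]. apply Cmod_eq_0 in H0.
    subst z. simpl. ring.
  - assert (Hz : 0 < Cmod z) by (pose proof (Cmod_ge_0 z); lra).
    exists (Cconj z * RtoC (/ Cmod z))%C. split.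
    + rewrite Cmod_mult, Cmod_conj, Cmod_R, Rabs_right.
      * rewrite Rinv_r; lra.
      * apply Rle_ge, Rlt_le, Rinv_0_lt_compat, Hz.
    + replace (Cconj z * RtoC (/ Cmod z) * z)%C
        with ((z * Cconj z) * RtoC (/ Cmod z))%C by ring.
      rewrite <- Cmod2_conj, <- RtoC_mult. simpl. field. exact H0.
Qed.

(** The mean value theorem with equality fails for complex values, but it holds for the real part of
    [u * c], where [u] rotates the total increment onto the positive real axis. *)
Lemma Kderiv_increment (c dc : R -> C) (M : R) :
  (forall t, 0 <= t <= 1 -> Kderiv c t (dc t)) ->
  (forall t, 0 <= t <= 1 -> Cmod (dc t) <= M) ->
  Cmod (c 1 - c 0)%C <= M.
Proof.
  intros Hc HM. destruct (Cmod_as_fst (c 1 - c 0)%C) as (u & Hu & E).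
  rewrite <- E.
  destruct (MVT_gen (fun t => fst (u * c t)%C) 0 1 (fun t => fst (u * dc t)%C))
    as (x & Hx & Ex).
  - intros x. rewrite Rmin_left, Rmax_right by lra. intros Hx.
    assert (K : Kderiv (fun s => u * c s)%C x (u * dc x)%C).
    { eapply Kderiv_eq; [apply Kderiv_mult; [apply Kderiv_const | apply Hc; lra]|].
      cbv beta. ring. }
    exact (proj1 K).
  - intros x. rewrite Rmin_left, Rmax_right by lra. intros Hx.
    apply continuity_pt_filterlim.
    assert (K : Kcont (fun s => u * c s)%C x).
    { apply Kcont_mult; [apply Kcont_const | eapply Kderiv_cont, Hc; lra]. }
    exact (proj1 K).
  - rewrite Rmin_left, Rmax_right in Hx by lra.
    replace (fst (u * (c 1 - c 0))%C) with (fst (u * c 1%R)%C - fst (u * c 0%R)%C)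
      by (simpl; ring).
    cbv beta in Ex. rewrite Ex, Rminus_0_r, Rmult_1_r.
    eapply Rle_trans; [apply Rle_abs|]. eapply Rle_trans; [apply fst_le_Cmod|].
    rewrite Cmod_mult. specialize (HM x Hx).
    pose proof (Cmod_ge_0 (dc x)). pose proof (Cmod_ge_0 u). nra.
Qed.

(** * Integrals of complex-valued functions over [[0, 1]] *)

Definition CI (c : R -> C) : C :=
  (RInt (fun t => fst (c t)) 0 1, RInt (fun t => snd (c t)) 0 1).

Definition cont01 (c : R -> C) : Prop := forall t, 0 <= t <= 1 -> Kcont c t.

Lemma ex_RInt_01 (g : R -> R) :
  (forall t, 0 <= t <= 1 -> continuous g t) -> ex_RInt g 0 1.
Proof.
  intros H. apply (@ex_RInt_continuous R_CompleteNormedModule).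
  rewrite Rmin_left, Rmax_right by lra. exact H.
Qed.

Lemma cont01_ex_RInt (c : R -> C) :
  cont01 c -> ex_RInt (fun t => fst (c t)) 0 1 /\ ex_RInt (fun t => snd (c t)) 0 1.
Proof.
  intros H. split; apply ex_RInt_01; intros t Ht; apply (H t Ht).
Qed.

Lemma CI_ext (c e : R -> C) : (forall t, 0 <= t <= 1 -> c t = e t) -> CI c = CI e.
Proof.
  intros H. unfold CI. f_equal; apply (@RInt_ext R_CompleteNormedModule);
    rewrite Rmin_left, Rmax_right by lra; intros t Ht; rewrite H by lra; reflexivity.
Qed.

Lemma RInt_lincomb (g h : R -> R) (p q : R) :
  ex_RInt g 0 1 -> ex_RInt h 0 1 ->
  RInt (fun t => p * g t + q * h t) 0 1 = p * RInt g 0 1 + q * RInt h 0 1.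
Proof.
  intros Hg Hh. apply (@is_RInt_unique R_CompleteNormedModule).
  apply (@is_RInt_plus R_NormedModule (fun t => p * g t) (fun t => q * h t));
    apply (@is_RInt_scal R_NormedModule); apply (@RInt_correct R_CompleteNormedModule);
    assumption.
Qed.

Lemma CI_scal (a : C) (c : R -> C) : cont01 c -> CI (fun t => a * c t)%C = (a * CI c)%C.
Proof.
  intros Hc. destruct (cont01_ex_RInt c Hc) as [H1 H2].
  apply injective_projections; simpl.
  - replace (fst a * _ - snd a * _)
      with (fst a * RInt (fun t => fst (c t)) 0 1
            + - snd a * RInt (fun t => snd (c t)) 0 1) by ring.
    rewrite <- RInt_lincomb by assumption.
    apply (@RInt_ext R_CompleteNormedModule). intros t _. simpl. ring.
  - rewrite <- RInt_lincomb by assumption. reflexivity.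
Qed.

Lemma cont01_mult (c e : R -> C) :
  cont01 c -> cont01 e -> cont01 (fun t => c t * e t)%C.
Proof. intros H1 H2 t Ht. apply Kcont_mult; [apply H1 | apply H2]; exact Ht. Qed.

Lemma cont01_const (a : C) : cont01 (fun _ => a).
Proof. intros t _. apply Kcont_const. Qed.

Lemma cont01_minus (c e : R -> C) :
  cont01 c -> cont01 e -> cont01 (fun t => c t - e t)%C.
Proof.
  intros H1 H2 t Ht. destruct (H1 t Ht), (H2 t Ht).
  split; apply (@continuous_minus R_UniformSpace R_AbsRing R_NormedModule); assumption.
Qed.

Lemma CI_minus (c e : R -> C) :
  cont01 c -> cont01 e -> CI (fun t => c t - e t)%C = (CI c - CI e)%C.
Proof.
  intros Hc He. destruct (cont01_ex_RInt c Hc), (cont01_ex_RInt e He).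
  unfold CI, Cminus, Cplus, Copp; simpl.
  f_equal; apply (@RInt_minus R_CompleteNormedModule); assumption.
Qed.

(** Rotating the integral to a nonnegative real reduces the claim to one real integral; estimating
    the two components separately would lose a constant factor, and the sharp constant matters for
    the bounds by [M]. *)
Lemma CI_norm (c : R -> C) (M : R) :
  cont01 c -> (forall t, 0 <= t <= 1 -> Cmod (c t) <= M) -> Cmod (CI c) <= M.
Proof.
  intros Hc HM. destruct (Cmod_as_fst (CI c)) as (u & Hu & E). rewrite <- E.
  rewrite <- CI_scal by exact Hc. unfold CI. simpl fst.
  assert (Hk : cont01 (fun t => u * c t)%C)
    by (apply cont01_mult; [apply cont01_const | exact Hc]).
  destruct (cont01_ex_RInt _ Hk) as [Hi _].
  eapply Rle_trans; [apply Rle_abs|].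
  eapply Rle_trans; [apply (abs_RInt_le_const _ 0 1 M); [lra | exact Hi |] | lra].
  intros t Ht. eapply Rle_trans; [apply (fst_le_Cmod (u * c t)%C)|].
  rewrite Cmod_mult. specialize (HM t Ht).
  pose proof (Cmod_ge_0 (c t)). pose proof (Cmod_ge_0 u). nra.
Qed.

Lemma CI_derive (c dc : R -> C) :
  (forall t, 0 <= t <= 1 -> Kderiv c t (dc t)) -> cont01 dc ->
  CI dc = (c 1 - c 0)%C.
Proof.
  intros Hc Hd. unfold CI, Cminus, Cplus, Copp; simpl. f_equal;
    apply (@is_RInt_unique R_CompleteNormedModule).
  - apply (@is_RInt_derive R_CompleteNormedModule (fun t => fst (c t)));
    rewrite Rmin_left, Rmax_right by lra; intros t Ht; [apply Hc | apply Hd]; exact Ht.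
  - apply (@is_RInt_derive R_CompleteNormedModule (fun t => snd (c t)));
    rewrite Rmin_left, Rmax_right by lra; intros t Ht; [apply Hc | apply Hd]; exact Ht.
Qed.

Lemma CI_const (a : C) : CI (fun _ => a) = a.
Proof.
  rewrite (CI_derive (fun t => 0 + RtoC t * a)%C).
  - ring.
  - intros t _. apply Kderiv_segment.
  - apply cont01_const.
Qed.

(** Affine substitution on each half, used to cut a segment at its midpoint. The [+ 0] makes both
    halves instances of the same substitution. *)
Lemma RInt_halves (g : R -> R) :
  (forall t, 0 <= t <= 1 -> continuous g t) ->
  RInt g 0 1 = / 2 * RInt (fun t => g (/ 2 * t + 0)) 0 1
             + / 2 * RInt (fun t => g (/ 2 * t + / 2)) 0 1.
Proof.
  intros Hg.
  assert (Hc : forall k t, 0 <= k <= / 2 -> 0 <= t <= 1 ->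
            continuous (fun s => g (/ 2 * s + k)) t).
  { intros k t Hk Ht. apply (continuous_comp (fun s => / 2 * s + k) g).
    - apply (@ex_derive_continuous R_AbsRing R_NormedModule). auto_derive. exact I.
    - apply Hg. lra. }
  assert (Hs : forall k a b, a = / 2 * 0 + k -> b = / 2 * 1 + k -> 0 <= k <= / 2 ->
            / 2 * RInt (fun t => g (/ 2 * t + k)) 0 1 = RInt g a b).
  { intros k a b -> -> Hk.
    rewrite <- (RInt_comp_lin (V := R_CompleteNormedModule) g).
    - symmetry. apply (@RInt_scal R_CompleteNormedModule).
      apply ex_RInt_01. intros t Ht. apply Hc; assumption.
    - apply (@ex_RInt_continuous R_CompleteNormedModule).
      rewrite Rmin_left, Rmax_right by lra. intros t Ht. apply Hg. lra. }
  rewrite (Hs 0 0 (/ 2)), (Hs (/ 2) (/ 2) 1) by lra.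
  symmetry. apply (@RInt_Chasles R_CompleteNormedModule);
    apply (@ex_RInt_continuous R_CompleteNormedModule);
    rewrite Rmin_left, Rmax_right by lra; intros t Ht; apply Hg; lra.
Qed.

Lemma CI_halves (c : R -> C) :
  cont01 c ->
  CI c = (RtoC (/ 2) * CI (fun t => c (/ 2 * t + 0)%R)
          + RtoC (/ 2) * CI (fun t => c (/ 2 * t + / 2)%R))%C.
Proof.
  intros Hc. unfold CI.
  rewrite (RInt_halves (fun t => fst (c t))), (RInt_halves (fun t => snd (c t)))
    by (intros t Ht; apply (Hc t Ht)).
  apply injective_projections; simpl; ring.
Qed.

Lemma RInt_rev (g : R -> R) :
  (forall t, 0 <= t <= 1 -> continuous g t) ->
  RInt (fun t => g (-1 * t + 1)) 0 1 = RInt g 0 1.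
Proof.
  intros Hg.
  rewrite <- (opp_RInt_swap (V := R_CompleteNormedModule) g 1 0).
  - replace (RInt g 1 0) with (RInt g (-1 * 0 + 1) (-1 * 1 + 1)) by (f_equal; lra).
    rewrite <- (RInt_comp_lin (V := R_CompleteNormedModule) g).
    + rewrite (@RInt_scal R_CompleteNormedModule).
      * assert (E : forall x : R, x = - (-1 * x)) by (intros; ring). apply E.
      * apply ex_RInt_01. intros t Ht. apply (continuous_comp (fun s => -1 * s + 1) g).
        -- apply (@ex_derive_continuous R_AbsRing R_NormedModule). auto_derive. exact I.
        -- apply Hg. lra.
    + apply (@ex_RInt_continuous R_CompleteNormedModule).
      rewrite Rmin_right, Rmax_left by lra. intros t Ht. apply Hg. lra.
  - apply (@ex_RInt_continuous R_CompleteNormedModule).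
    rewrite Rmin_right, Rmax_left by lra. intros t Ht. apply Hg. lra.
Qed.

Lemma CI_rev (c : R -> C) : cont01 c -> CI (fun t => c (-1 * t + 1)%R) = CI c.
Proof.
  intros Hc. unfold CI. f_equal.
  - apply (RInt_rev (fun t => fst (c t))). intros t Ht. apply (Hc t Ht).
  - apply (RInt_rev (fun t => snd (c t))). intros t Ht. apply (Hc t Ht).
Qed.

(** * Primitives of analytic functions *)

(** The contour integral of [f] along the straight segment from [a] to [b]. *)
Definition seg (f : C -> C) (a b : C) : C :=
  ((b - a) * CI (fun t => f (a + RtoC t * (b - a))%C))%C.

Definition cont_D (f : C -> C) : Prop := forall z, inD z -> Ccont f z.

Lemma analytic_cont_D (f : C -> C) : analytic_D f -> cont_D f.
Proof. intros Hf z Hz. destruct (Hf z Hz) as [l Hl]. eapply Cderiv_cont, Hl. Qed.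

Lemma segment_ball (p a b : C) (r t : R) :
  Cmod (a - p) <= r -> Cmod (b - p) <= r -> 0 <= t <= 1 ->
  Cmod (a + RtoC t * (b - a) - p)%C <= r.
Proof.
  intros Ha Hb Ht.
  replace (a + RtoC t * (b - a) - p)%C
    with (RtoC (1 - t) * (a - p) + RtoC t * (b - p))%C by (rewrite RtoC_minus; ring).
  eapply Rle_trans; [apply Cmod_triangle|]. rewrite !Cmod_mult, !Cmod_R.
  rewrite !Rabs_right by lra. nra.
Qed.

Lemma segment_D (a b : C) (t : R) :
  inD a -> inD b -> 0 <= t <= 1 -> inD (a + RtoC t * (b - a))%C.
Proof.
  unfold inD. intros Ha Hb Ht.
  pose proof (segment_ball 0 a b (Rmax (Cmod a) (Cmod b)) t) as H.
  replace (a - 0)%C with a in H by ring. replace (b - 0)%C with b in H by ring.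
  replace (a + RtoC t * (b - a) - 0)%C with (a + RtoC t * (b - a))%C in H by ring.
  eapply Rle_lt_trans; [apply H; [apply Rmax_l | apply Rmax_r | exact Ht]|].
  apply Rmax_lub_lt; assumption.
Qed.

(** The leading [0 +] keeps rays literally in the form treated by [Kderiv_segment]. *)
Lemma ray_D (z : C) (t : R) : inD z -> 0 <= t <= 1 -> inD (0 + RtoC t * z)%C.
Proof.
  unfold inD. intros Hz Ht. replace (0 + RtoC t * z)%C with (RtoC t * z)%C by ring.
  rewrite Cmod_mult, Cmod_R, Rabs_right by lra. pose proof (Cmod_ge_0 z). nra.
Qed.

Lemma seg_cont (f : C -> C) (a b : C) :
  cont_D f -> inD a -> inD b -> cont01 (fun t => f (a + RtoC t * (b - a))%C).
Proof.
  intros Hf Ha Hb t Ht. apply (Kcont_comp f (fun t => a + RtoC t * (b - a))%C).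
  - apply Hf, segment_D; assumption.
  - eapply Kderiv_cont, Kderiv_segment.
Qed.

Lemma seg_rev (f : C -> C) (a b : C) :
  cont_D f -> inD a -> inD b -> seg f b a = (- seg f a b)%C.
Proof.
  intros Hf Ha Hb. unfold seg.
  rewrite <- (CI_rev (fun t => f (a + RtoC t * (b - a))%C)) by (apply seg_cont; assumption).
  rewrite (CI_ext (fun t => f (b + RtoC t * (a - b))%C)
             (fun t => f (a + RtoC (-1 * t + 1) * (b - a))%C)).
  - ring.
  - intros t _. f_equal. rewrite RtoC_plus, RtoC_mult.
    replace (RtoC (-1)) with (- (1))%C by (rewrite <- RtoC_opp; f_equal). ring.
Qed.

Definition mid (a b : C) : C := (RtoC (/ 2) * (a + b))%C.

Lemma RtoC_half : RtoC (/ 2) = (/ RtoC 2)%C.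
Proof. apply RtoC_inv. lra. Qed.

Lemma mid_half (a b : C) : mid a b = (a + RtoC (/ 2) * (b - a))%C.
Proof. unfold mid. rewrite RtoC_half. field. Qed.

Lemma mid_sub_l (a b : C) : (mid a b - a = RtoC (/ 2) * (b - a))%C.
Proof. rewrite mid_half. ring. Qed.

Lemma mid_sub_r (a b : C) : (b - mid a b = RtoC (/ 2) * (b - a))%C.
Proof. unfold mid. rewrite RtoC_half. field. Qed.

Lemma mid_ball (p a b : C) (r : R) :
  Cmod (a - p) <= r -> Cmod (b - p) <= r -> Cmod (mid a b - p) <= r.
Proof.
  intros Ha Hb. rewrite mid_half. apply segment_ball; [assumption..|lra].
Qed.

Lemma mid_D (a b : C) : inD a -> inD b -> inD (mid a b).
Proof. intros Ha Hb. rewrite mid_half. apply segment_D; [assumption..|lra]. Qed.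

Lemma seg_mid (f : C -> C) (a b : C) :
  cont_D f -> inD a -> inD b -> seg f a b = (seg f a (mid a b) + seg f (mid a b) b)%C.
Proof.
  intros Hf Ha Hb. unfold seg at 1.
  rewrite (CI_halves (fun t => f (a + RtoC t * (b - a))%C))
    by (apply seg_cont; assumption).
  unfold seg. rewrite mid_sub_l, mid_sub_r.
  rewrite (CI_ext (fun t => f (a + RtoC (/ 2 * t + 0) * (b - a))%C)
             (fun t => f (a + RtoC t * (RtoC (/ 2) * (b - a)))%C)).
  rewrite (CI_ext (fun t => f (a + RtoC (/ 2 * t + / 2) * (b - a))%C)
             (fun t => f (mid a b + RtoC t * (RtoC (/ 2) * (b - a)))%C)).
  - ring.
  - intros t _. f_equal. rewrite mid_half, RtoC_plus, RtoC_mult. ring.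
  - intros t _. f_equal. rewrite RtoC_plus, RtoC_mult. ring.
Qed.

Lemma seg_norm (f : C -> C) (a b : C) (M : R) :
  cont_D f -> inD a -> inD b ->
  (forall t, 0 <= t <= 1 -> Cmod (f (a + RtoC t * (b - a))%C) <= M) ->
  Cmod (seg f a b) <= Cmod (b - a) * M.
Proof.
  intros Hf Ha Hb HM. unfold seg. rewrite Cmod_mult.
  apply Rmult_le_compat_l; [apply Cmod_ge_0|].
  apply CI_norm; [apply seg_cont; assumption | exact HM].
Qed.

Lemma seg_derive (F f : C -> C) (a b : C) :
  cont_D f -> (forall z, inD z -> Cderiv F z (f z)) -> inD a -> inD b ->
  seg f a b = (F b - F a)%C.
Proof.
  intros Hf HF Ha Hb. unfold seg.
  rewrite <- CI_scal by (apply seg_cont; assumption).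
  rewrite (CI_derive (fun t => F (a + RtoC t * (b - a))%C)).
  - f_equal; [f_equal; ring | f_equal; f_equal; ring].
  - intros t Ht. eapply Kderiv_eq.
    + apply (Kderiv_comp F (fun t => a + RtoC t * (b - a))%C).
      * apply HF, segment_D; assumption.
      * apply Kderiv_segment.
    + ring.
  - apply cont01_mult; [apply cont01_const | apply seg_cont; assumption].
Qed.

Lemma cont_D_minus (f g : C -> C) :
  cont_D f -> cont_D g -> cont_D (fun z => f z - g z)%C.
Proof.
  intros Hf Hg z Hz eps He.
  destruct (Hf z Hz (eps / 2)) as (d1 & Hd1 & F); [lra|].
  destruct (Hg z Hz (eps / 2)) as (d2 & Hd2 & G); [lra|].
  exists (Rmin d1 d2); split; [apply Rmin_pos; assumption|]. intros h Hh.
  specialize (F h (Rlt_le_trans _ _ _ Hh (Rmin_l _ _))).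
  specialize (G h (Rlt_le_trans _ _ _ Hh (Rmin_r _ _))).
  replace (f (z + h)%C - g (z + h)%C - (f z - g z))%C
    with ((f (z + h)%C - f z) - (g (z + h)%C - g z))%C by ring.
  eapply Rle_lt_trans; [apply Cmod_triangle_sub | lra].
Qed.

Lemma seg_minus (f g : C -> C) (a b : C) :
  cont_D f -> cont_D g -> inD a -> inD b ->
  seg (fun z => f z - g z)%C a b = (seg f a b - seg g a b)%C.
Proof.
  intros Hf Hg Ha Hb. unfold seg.
  rewrite (CI_minus (fun t => f (a + RtoC t * (b - a))%C)) by (apply seg_cont; assumption).
  ring.
Qed.

(** * Goursat's lemma on triangles and primitives on the disc *)

Definition triangle : Type := (C * C * C)%type.

Definition boundary (f : C -> C) (T : triangle) : C :=
  let '(a, b, c) := T in (seg f a b + seg f b c + seg f c a)%C.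

Definition all_vertices (P : C -> Prop) (T : triangle) : Prop :=
  let '(a, b, c) := T in P a /\ P b /\ P c.

Definition sides_le (d : R) (T : triangle) : Prop :=
  let '(a, b, c) := T in Cmod (b - a) <= d /\ Cmod (c - b) <= d /\ Cmod (a - c) <= d.

(** All four pieces inherit the orientation of the whole triangle, so each side of the medial
    triangle [sub4] is run through once in each direction and cancels. *)
Definition sub1 (T : triangle) : triangle := let '(a, b, c) := T in (a, mid a b, mid c a).
Definition sub2 (T : triangle) : triangle := let '(a, b, c) := T in (mid a b, b, mid b c).
Definition sub3 (T : triangle) : triangle := let '(a, b, c) := T in (mid c a, mid b c, c).
Definition sub4 (T : triangle) : triangle :=
  let '(a, b, c) := T in (mid a b, mid b c, mid c a).

(** Deciding by comparison makes the nested sequence a plain iteration. [sub4] is the default: when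
    the other three fail the test, the triangle inequality forces it to carry at least a quarter of
    the integral. *)
Definition step (f : C -> C) (T : triangle) : triangle :=
  let large T' := Rle_dec (Cmod (boundary f T)) (4 * Cmod (boundary f T')) in
  if large (sub1 T) then sub1 T else if large (sub2 T) then sub2 T
  else if large (sub3 T) then sub3 T else sub4 T.

Lemma step_cases (f : C -> C) (P : triangle -> Prop) (T : triangle) :
  P (sub1 T) -> P (sub2 T) -> P (sub3 T) -> P (sub4 T) -> P (step f T).
Proof. intros. unfold step. repeat destruct Rle_dec; assumption. Qed.

Lemma boundary_subdivision (f : C -> C) (T : triangle) :
  cont_D f -> all_vertices inD T ->
  boundary f T = (boundary f (sub1 T) + boundary f (sub2 T)
                  + boundary f (sub3 T) + boundary f (sub4 T))%C.
Proof.
  destruct T as [[a b] c]. simpl. intros Hf (Ha & Hb & Hc).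
  rewrite (seg_mid f a b), (seg_mid f b c), (seg_mid f c a) by assumption.
  assert (Hm : inD (mid a b) /\ inD (mid b c) /\ inD (mid c a))
    by (repeat split; apply mid_D; assumption). destruct Hm as (Hab & Hbc & Hca).
  rewrite (seg_rev f (mid a b) (mid b c)), (seg_rev f (mid b c) (mid c a)),
    (seg_rev f (mid c a) (mid a b)) by assumption.
  ring.
Qed.

Lemma step_large (f : C -> C) (T : triangle) :
  cont_D f -> all_vertices inD T ->
  Cmod (boundary f T) <= 4 * Cmod (boundary f (step f T)).
Proof.
  intros Hf HT. pose proof (boundary_subdivision f T Hf HT) as E.
  pose proof (Cmod_triangle (boundary f (sub1 T) + boundary f (sub2 T)
                  + boundary f (sub3 T)) (boundary f (sub4 T))) as T1.
  pose proof (Cmod_triangle (boundary f (sub1 T) + boundary f (sub2 T))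
                  (boundary f (sub3 T))) as T2.
  pose proof (Cmod_triangle (boundary f (sub1 T)) (boundary f (sub2 T))) as T3.
  rewrite <- E in T1. unfold step. repeat destruct Rle_dec; try assumption. lra.
Qed.

Lemma step_vertices (f : C -> C) (T : triangle) :
  all_vertices inD T -> all_vertices inD (step f T).
Proof.
  destruct T as [[a b] c]. intros (Ha & Hb & Hc).
  assert (Hm : inD (mid a b) /\ inD (mid b c) /\ inD (mid c a))
    by (repeat split; apply mid_D; assumption). destruct Hm as (Hab & Hbc & Hca).
  apply step_cases; simpl; auto.
Qed.

(** The open disc is not closed under limits; a fixed radius [r < 1] is, and it keeps the limit
    point of the nested triangles inside the disc. The form [z - 0] matches [mid_ball]. *)
Lemma step_ball (f : C -> C) (r : R) (T : triangle) :
  all_vertices (fun z => Cmod (z - 0) <= r) T ->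
  all_vertices (fun z => Cmod (z - 0) <= r) (step f T).
Proof.
  destruct T as [[a b] c]. intros (Ha & Hb & Hc).
  pose proof (mid_ball 0 a b r Ha Hb). pose proof (mid_ball 0 b c r Hb Hc).
  pose proof (mid_ball 0 c a r Hc Ha).
  apply step_cases; simpl; auto.
Qed.

Lemma Cmod_half (z : C) (d : R) : Cmod z <= d -> Cmod (RtoC (/ 2) * z) <= d / 2.
Proof. intros H. rewrite Cmod_mult, Cmod_R, Rabs_right by lra. lra. Qed.

(** Up to sign, each side of a piece is half of a side of the original triangle. *)
Lemma step_sides (f : C -> C) (d : R) (T : triangle) :
  sides_le d T -> sides_le (d / 2) (step f T).
Proof.
  destruct T as [[a b] c]. intros (Ha & Hb & Hc).
  apply Cmod_half in Ha, Hb, Hc.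
  assert (H : forall x y, x = y \/ x = (- y)%C -> Cmod y <= d / 2 -> Cmod x <= d / 2)
    by (intros x y [-> | ->]; rewrite ?Cmod_opp; auto).
  rewrite RtoC_half in *.
  apply step_cases; simpl; unfold mid; rewrite RtoC_half; repeat split;
    first [ apply (H _ _ (or_introl eq_refl)); assumption
          | eapply H; [left | exact Ha]; field | eapply H; [right | exact Ha]; field
          | eapply H; [left | exact Hb]; field | eapply H; [right | exact Hb]; field
          | eapply H; [left | exact Hc]; field | eapply H; [right | exact Hc]; field ].
Qed.

(** First vertices form the Cauchy sequence that locates the point to which the nested triangles
    shrink. *)
Definition apex (T : triangle) : C := fst (fst T).

Lemma step_apex (f : C -> C) (d : R) (T : triangle) :
  sides_le d T -> Cmod (apex (step f T) - apex T) <= d / 2.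
Proof.
  destruct T as [[a b] c]. intros (Ha & Hb & Hc).
  assert (0 <= d) by (pose proof (Cmod_ge_0 (b - a)); lra).
  apply Cmod_half in Ha, Hb, Hc.
  apply (step_cases f (fun T' => Cmod (apex T' - a) <= d / 2));
    unfold apex; simpl; rewrite ?mid_sub_l; try assumption.
  - replace (a - a)%C with (RtoC 0) by ring. rewrite Cmod_0. lra.
  - rewrite Cmod_sub_sym, mid_sub_r. exact Hc.
Qed.

Lemma halving_small (d eps : R) : 0 <= d -> 0 < eps -> exists n, d / 2 ^ n < eps.
Proof.
  intros Hd He.
  destruct (Pow_x_infinity 2) with (b := d / eps + 1) as [N HN].
  - rewrite Rabs_right; lra.
  - exists N. specialize (HN N (le_n N)).
    assert (P : 0 < 2 ^ N) by (apply pow_lt; lra).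
    rewrite Rabs_right in HN by lra.
    apply Rlt_div_l; [exact P|].
    assert (E : eps * (d / eps + 1) = d + eps) by (field; lra).
    assert (eps * (d / eps + 1) <= eps * 2 ^ N) by (apply Rmult_le_compat_l; lra).
    lra.
Qed.

(** Telescoping a geometric series shows that the sequence is Cauchy with error [d / 2^n].
    Completeness is used on each coordinate separately, and adding the two coordinates costs the
    factor 2. *)
Lemma nested_limit (u : nat -> C) (d : R) :
  (forall n, Cmod (u (S n) - u n) <= d / 2 ^ n / 2) ->
  exists l, forall n, Cmod (l - u n) <= 2 * (d / 2 ^ n).
Proof.
  intros Hu.
  assert (Hd : 0 <= d) by (pose proof (Hu 0%nat) as H; pose proof (Cmod_ge_0 (u 1%nat - u 0%nat));
    simpl in H; lra).
  assert (P : forall n, 0 < 2 ^ n) by (intros; apply pow_lt; lra).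
  assert (Hk : forall n k, Cmod (u (k + n)%nat - u n) <= d / 2 ^ n - d / 2 ^ (k + n)).
  { intros n k. induction k as [|k IH]; simpl.
    - replace (u n - u n)%C with (RtoC 0) by ring. rewrite Cmod_0. lra.
    - replace (u (S (k + n)) - u n)%C
        with ((u (S (k + n)) - u (k + n)%nat) + (u (k + n)%nat - u n))%C by ring.
      eapply Rle_trans; [apply Cmod_triangle|]. specialize (Hu (k + n)%nat).
      replace (d / (2 * 2 ^ (k + n))) with (d / 2 ^ (k + n) / 2)
        by (field; apply Rgt_not_eq, P). lra. }
  assert (Hkn : forall n m, (n <= m)%nat -> Cmod (u m - u n) <= d / 2 ^ n).
  { intros n m Hnm. replace m with ((m - n) + n)%nat by (apply Nat.sub_add; exact Hnm).
    eapply Rle_trans; [apply Hk|].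
    assert (0 <= d / 2 ^ (m - n + n)) by (apply Rdiv_le_0_compat; [exact Hd | apply P]).
    lra. }
  assert (lim : forall g : C -> R, (forall z w, Rabs (g z - g w) <= Cmod (z - w)) ->
     exists l, forall n, Rabs (l - g (u n)) <= d / 2 ^ n).
  { intros g Hg. destruct (Rcomplete.R_complete (fun n => g (u n))) as [l Hl].
    - intros eps He. destruct (halving_small d (eps / 2)) as [N HN]; [exact Hd | lra|]. exists N.
      intros n m Hn Hm. unfold Rdist.
      replace (g (u n) - g (u m)) with ((g (u n) - g (u N)) - (g (u m) - g (u N))) by ring.
      eapply Rle_lt_trans; [apply Rabs_triang|]. rewrite Rabs_Ropp.
      pose proof (Hg (u n) (u N)). pose proof (Hg (u m) (u N)).
      pose proof (Hkn N n Hn). pose proof (Hkn N m Hm). lra.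
    - exists l. intros n. apply le_epsilon. intros eps He.
      destruct (Hl eps He) as [N HN]. specialize (HN (max N n) (Nat.le_max_l _ _)).
      unfold Rdist in HN. rewrite Rabs_minus_sym in HN.
      pose proof (Hg (u (max N n)) (u n)). pose proof (Hkn n (max N n) (Nat.le_max_r _ _)).
      replace (l - g (u n)) with ((l - g (u (max N n))) + (g (u (max N n)) - g (u n))) by ring.
      eapply Rle_trans; [apply Rabs_triang|]. lra. }
  destruct (lim fst) as [l1 H1].
  { intros z w. apply (fst_le_Cmod (z - w)%C). }
  destruct (lim snd) as [l2 H2].
  { intros z w. apply (snd_le_Cmod (z - w)%C). }
  exists (l1, l2). intros n. eapply Rle_trans; [apply Cmod_le_sum|].
  specialize (H1 n). specialize (H2 n). simpl. unfold Rminus in H1, H2. lra.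
Qed.

(* The boundary integral of an affine function vanishes, so only the second-order error
   of [f] at the limit point of the nested triangles contributes. *)
Lemma boundary_small (f : C -> C) (l : C) (p : C) (eps d : R) (T : triangle) :
  cont_D f -> all_vertices inD T -> sides_le d T -> Cmod (p - apex T) <= 2 * d ->
  0 <= eps ->
  (forall z, Cmod (z - p) <= 3 * d -> Cmod (f z - f p - l * (z - p)) <= eps * Cmod (z - p)) ->
  Cmod (boundary f T) <= 9 * eps * (d * d).
Proof.
  destruct T as [[a b] c]. unfold apex; simpl.
  intros Hf (Ha & Hb & Hc) (Hab & Hbc & Hca) Hp He H.
  assert (Hd : 0 <= d) by (pose proof (Cmod_ge_0 (b - a)); lra).
  set (A := fun z : C => (f p + l * (z - p))%C).
  set (P := fun z : C => (f p * z + l * (RtoC (/ 2) * ((z - p) * (z - p))))%C).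
  assert (HA : forall z, Cderiv A z l).
  { intros z. eapply Cderiv_eq.
    - apply Cderiv_plus; [apply Cderiv_const|].
      apply Cderiv_mult; [apply Cderiv_const|].
      apply Cderiv_minus; [apply Cderiv_id | apply Cderiv_const].
    - cbv beta. ring. }
  assert (HP : forall z, Cderiv P z (A z)).
  { intros z.
    assert (D : Cderiv (fun z => z - p)%C z (RtoC 1 - 0)%C)
      by (apply Cderiv_minus; [apply Cderiv_id | apply Cderiv_const]).
    eapply Cderiv_eq.
    - apply Cderiv_plus.
      + apply Cderiv_mult; [apply Cderiv_const | apply Cderiv_id].
      + apply Cderiv_mult; [apply Cderiv_const|].
        apply Cderiv_mult; [apply Cderiv_const|]. apply Cderiv_mult; exact D.
    - unfold A; cbv beta. rewrite RtoC_half. field. }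
  assert (cA : cont_D A) by (intros z _; eapply Cderiv_cont, HA).
  (* Points of a side lie within [d] of [a], hence within [3 * d] of [p]; summing over three sides
     of length at most [d] produces the factor 9. *)
  assert (S : forall v w, inD v -> inD w -> Cmod (v - a) <= d -> Cmod (w - a) <= d ->
             Cmod (w - v) <= d ->
             Cmod (seg f v w - (P w - P v))%C <= d * (eps * (3 * d))).
  { intros v w Hv Hw Hva Hwa Hvw.
    rewrite <- (seg_derive P A) by (auto; intros; apply HP).
    rewrite <- seg_minus by assumption.
    eapply Rle_trans; [apply (seg_norm _ v w (eps * (3 * d))); auto|].
    - apply cont_D_minus; assumption.
    - intros t Ht. set (z := (v + RtoC t * (w - v))%C).
      assert (Hz : Cmod (z - p) <= 3 * d).
      { replace (z - p)%C with ((z - a) - (p - a))%C by ring.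
        eapply Rle_trans; [apply Cmod_triangle_sub|].
        pose proof (segment_ball a v w d t Hva Hwa Ht) as B. fold z in B. lra. }
      unfold A. replace (f z - (f p + l * (z - p)))%C with (f z - f p - l * (z - p))%C by ring.
      eapply Rle_trans; [apply H, Hz|]. apply Rmult_le_compat_l; assumption.
    - apply Rmult_le_compat_r; [|exact Hvw]. apply Rmult_le_pos; lra. }
  assert (Haa : Cmod (a - a) <= d)
    by (replace (a - a)%C with (RtoC 0) by ring; rewrite Cmod_0; exact Hd).
  assert (Hca' : Cmod (c - a) <= d) by (rewrite Cmod_sub_sym; exact Hca).
  pose proof (S a b Ha Hb Haa Hab Hab) as S1.
  pose proof (S b c Hb Hc Hab Hca' Hbc) as S2.
  pose proof (S c a Hc Ha Hca' Haa Hca) as S3.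
  replace (seg f a b + seg f b c + seg f c a)%C
    with ((seg f a b - (P b - P a)) + (seg f b c - (P c - P b)) + (seg f c a - (P a - P c)))%C
    by ring.
  eapply Rle_trans; [apply Cmod_triangle|].
  eapply Rle_trans; [apply Rplus_le_compat_r, Cmod_triangle|]. lra.
Qed.

(** After [n] steps the integral has shrunk at most by [4^n], while the second-order bound near the
    limit point shrinks like the square of the side, also by [4^n]. The powers cancel and leave
    [9 * e * d^2] with [e] arbitrary. *)
Lemma Goursat (f : C -> C) (T : triangle) :
  analytic_D f -> all_vertices inD T -> boundary f T = 0.
Proof.
  intros Hf HT. pose proof (analytic_cont_D f Hf) as Hc.
  assert (Hr : exists r, r < 1 /\ all_vertices (fun z => Cmod (z - 0) <= r) T).
  { destruct T as [[a b] c]. destruct HT as (Ha & Hb & Hc').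
    exists (Rmax (Cmod a) (Rmax (Cmod b) (Cmod c))). split.
    - repeat apply Rmax_lub_lt; assumption.
    - simpl. replace (a - 0)%C with a by ring. replace (b - 0)%C with b by ring.
      replace (c - 0)%C with c by ring.
      repeat split; [apply Rmax_l| |]; (eapply Rle_trans; [|apply Rmax_r]);
        [apply Rmax_l | apply Rmax_r]. }
  destruct Hr as (r & Hr & HTr).
  assert (Hs : exists d, 0 < d /\ sides_le d T).
  { destruct T as [[a b] c].
    (* The summand 1 keeps [d] positive for degenerate triangles, since [d * d] becomes a
       denominator. *)
    exists (1 + Cmod (b - a) + Cmod (c - b) + Cmod (a - c)). simpl.
    pose proof (Cmod_ge_0 (b - a)). pose proof (Cmod_ge_0 (c - b)).
    pose proof (Cmod_ge_0 (a - c)). repeat split; lra. }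
  destruct Hs as (d & Hd & Hs).
  set (Tn := fun n => Nat.iter n (step f) T).
  assert (P : forall n, 0 < 2 ^ n) by (intros; apply pow_lt; lra).
  assert (I1 : forall n, all_vertices inD (Tn n))
    by (induction n; [exact HT | apply step_vertices; assumption]).
  assert (I2 : forall n, all_vertices (fun z => Cmod (z - 0) <= r) (Tn n))
    by (induction n; [exact HTr | apply step_ball; assumption]).
  assert (I3 : forall n, sides_le (d / 2 ^ n) (Tn n)).
  { induction n as [|n IH].
    - simpl. replace (d / 1) with d by field. exact Hs.
    - replace (d / 2 ^ S n) with (d / 2 ^ n / 2) by (simpl; field; apply Rgt_not_eq, P).
      apply (step_sides f), IH. }
  assert (I4 : forall n, Cmod (boundary f T) <= 4 ^ n * Cmod (boundary f (Tn n))).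
  { induction n as [|n IH]; [simpl; lra|].
    pose proof (step_large f (Tn n) Hc (I1 n)) as L.
    change (step f (Tn n)) with (Tn (S n)) in L. simpl pow.
    assert (0 < 4 ^ n) by (apply pow_lt; lra). nra. }
  destruct (nested_limit (fun n => apex (Tn n)) d) as [p Hp].
  { intros n. apply (step_apex f), I3. }
  assert (HpD : inD p).
  { destruct (halving_small d ((1 - r) / 2)) as [n Hn]; [lra..|]. specialize (Hp n). specialize (I2 n).
    destruct (Tn n) as [[a b] c]. destruct I2 as (Ha & _). unfold apex in Hp; simpl in Hp.
    unfold inD. replace p with ((p - a) + (a - 0))%C by ring.
    eapply Rle_lt_trans; [apply Cmod_triangle|]. lra. }
  destruct (Hf p HpD) as [l Hl]. rewrite Cderiv_eps in Hl.
  apply Cmod_eq_0. apply Rle_antisym; [|apply Cmod_ge_0].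
  apply le_epsilon. intros eps He. rewrite Rplus_0_l.
  set (e := eps / (9 * (d * d))).
  assert (Hdd : 0 < 9 * (d * d)) by nra.
  destruct (Hl e) as (delta & Hdelta & F); [apply Rdiv_lt_0_compat; assumption|].
  (* [boundary_small] wants the linear approximation up to distance three times the side bound. *)
  destruct (halving_small d (delta / 3)) as [n Hn]; [lra..|].
  eapply Rle_trans; [apply (I4 n)|].
  assert (B : Cmod (boundary f (Tn n)) <= 9 * e * (d / 2 ^ n * (d / 2 ^ n))).
  { apply (boundary_small f l p); auto.
    - apply Rlt_le, Rdiv_lt_0_compat; assumption.
    - intros z Hz. specialize (F (z - p)%C).
      replace (p + (z - p))%C with z in F by ring. apply F. lra. }
  assert (E4 : 4 ^ n = 2 ^ n * 2 ^ n)
    by (rewrite <- Rpow_mult_distr; f_equal; lra).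
  rewrite E4. specialize (P n).
  apply Rle_trans with (2 ^ n * 2 ^ n * (9 * e * (d / 2 ^ n * (d / 2 ^ n)))).
  - apply Rmult_le_compat_l; [nra | exact B].
  - right. unfold e. field. split; lra.
Qed.

Lemma seg_point (f : C -> C) (a : C) : seg f a a = 0.
Proof. unfold seg. replace (a - a)%C with (RtoC 0) by ring. ring. Qed.

(** Integrate from 0 to [z]. Goursat on the triangle [0, z, z + h] turns the increment into the
    integral over the segment from [z] to [z + h], which is [h] times a mean of values of [f] close
    to [f z]. *)
Lemma primitive_D (f : C -> C) :
  analytic_D f ->
  exists F, F (RtoC 0) = RtoC 0 /\ forall z, inD z -> Cderiv F z (f z).
Proof.
  intros Hf. pose proof (analytic_cont_D f Hf) as Hc.
  exists (fun z => seg f 0 z). split; [apply seg_point|].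
  intros z Hz. apply Cderiv_eps. intros eps He.
  destruct (Hc z Hz eps He) as (d & Hd & F).
  unfold inD in Hz.
  exists (Rmin d (1 - Cmod z)); split; [apply Rmin_pos; lra|]. intros h Hh.
  pose proof (Rlt_le_trans _ _ _ Hh (Rmin_l _ _)) as Hh1.
  pose proof (Rlt_le_trans _ _ _ Hh (Rmin_r _ _)) as Hh2.
  assert (Hzh : inD (z + h)%C)
    by (unfold inD; eapply Rle_lt_trans; [apply Cmod_triangle | lra]).
  assert (H0 : inD 0) by (unfold inD; rewrite Cmod_0; lra).
  pose proof (Goursat f (RtoC 0, z, (z + h)%C) Hf (conj H0 (conj Hz Hzh))) as G.
  simpl in G. rewrite (seg_rev f 0 (z + h)%C) in G by assumption.
  replace (seg f 0 (z + h)%C - seg f 0 z - f z * h)%C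
    with (seg f z (z + h)%C - h * f z)%C.
  2:{ replace (seg f z (z + h)%C) with (seg f 0 (z + h)%C - seg f 0 z)%C; [ring|].
      replace (seg f 0 (z + h)%C) with
        (seg f 0 z + seg f z (z + h)%C - (seg f 0 z + seg f z (z + h)%C - seg f 0 (z + h)%C))%C
        by ring.
      replace (seg f 0 z + seg f z (z + h)%C - seg f 0 (z + h)%C)%C with (RtoC 0)
        by (symmetry; etransitivity; [|exact G]; ring). ring. }
  unfold seg. replace (z + h - z)%C with h by ring.
  rewrite <- (CI_const (f z)) at 1.
  assert (K : cont01 (fun t => f (z + RtoC t * h)%C)).
  { pose proof (seg_cont f z (z + h)%C Hc Hz Hzh) as K.
    replace (z + h - z)%C with h in K by ring. exact K. }
  replace (h * CI (fun t => f (z + RtoC t * h)%C) - h * CI (fun _ => f z))%C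
    with (h * CI (fun t => f (z + RtoC t * h)%C - f z)%C)%C
    by (rewrite (CI_minus (fun t => f (z + RtoC t * h)%C))
          by (try apply cont01_const; exact K); ring).
  rewrite Cmod_mult, Rmult_comm. apply Rmult_le_compat_r; [apply Cmod_ge_0|].
  apply CI_norm.
  - apply cont01_minus; [exact K | apply cont01_const].
  - intros t Ht. apply Rlt_le, F. rewrite Cmod_mult, Cmod_R, Rabs_right by lra.
    pose proof (Cmod_ge_0 h). nra.
Qed.

(** * Cauchy's formula on centred circles *)

(* The circle is run through once over [[0, 1]]; integrals below carry the weight [circ r t]
   in place of [circ' = 2 PI i circ]. *)
Definition circ (r t : R) : C := (r * cos (2 * PI * t), r * sin (2 * PI * t)).

Lemma circ_derive (r t : R) : Kderiv (circ r) t (RtoC (2 * PI) * Ci * circ r t)%C.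
Proof.
  split; unfold circ; simpl; auto_derive; try exact I; ring.
Qed.

Lemma Cmod_circ (r t : R) : 0 <= r -> Cmod (circ r t) = r.
Proof.
  intros Hr. unfold circ, Cmod. simpl.
  replace (_ + _) with (r * r).
  - apply sqrt_square, Hr.
  - pose proof (sin2_cos2 (2 * PI * t)) as H. unfold Rsqr in H.
    transitivity (r * r * (sin (2 * PI * t) * sin (2 * PI * t)
                           + cos (2 * PI * t) * cos (2 * PI * t))); [rewrite H|]; ring.
Qed.

Lemma circ_closed (r : R) : circ r 1 = circ r 0.
Proof.
  unfold circ. rewrite Rmult_1_r, Rmult_0_r, cos_2PI, sin_2PI, cos_0, sin_0. reflexivity.
Qed.

Lemma circ_cont (r : R) : cont01 (circ r).
Proof. intros t _. eapply Kderiv_cont, circ_derive. Qed.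

Lemma circ_neq (r t : R) (z : C) : Cmod z < r -> (circ r t - z)%C <> 0.
Proof.
  intros H E. assert (E' : circ r t = z) by (rewrite <- (Cplus_0_r z), <- E; ring).
  assert (Hr : 0 <= r) by (pose proof (Cmod_ge_0 z); lra).
  rewrite <- E', Cmod_circ in H by exact Hr. lra.
Qed.

Lemma two_PI_Ci_neq : (RtoC (2 * PI) * Ci)%C <> 0.
Proof.
  pose proof PI_RGT_0. apply Cmult_neq_0; apply Cmod_gt_0.
  - rewrite Cmod_R, Rabs_right; lra.
  - rewrite Cmod_Ci. lra.
Qed.

(** Up to the nonzero factor [2 PI i], the integral is the increment of [G] once around a closed
    curve. [G] is differentiated only at points of the circle, so a pole inside is allowed. *)
Lemma circ_integral_derive (G g : C -> C) (r : R) :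
  (forall t, 0 <= t <= 1 -> Cderiv G (circ r t) (g (circ r t))) ->
  cont01 (fun t => g (circ r t)) ->
  CI (fun t => g (circ r t) * circ r t)%C = 0.
Proof.
  intros HG Hg.
  assert (K : cont01 (fun t => g (circ r t) * circ r t)%C)
    by (apply cont01_mult; [exact Hg | apply circ_cont]).
  assert (E : (RtoC (2 * PI) * Ci * CI (fun t => g (circ r t) * circ r t))%C = 0).
  { rewrite <- CI_scal by exact K.
    rewrite (CI_derive (fun t => G (circ r t))).
    - rewrite circ_closed. ring.
    - intros t Ht. eapply Kderiv_eq.
      + apply (Kderiv_comp G (circ r)); [apply HG, Ht | apply circ_derive].
      + ring.
    - apply cont01_mult; [apply cont01_const | exact K]. }
  destruct (Ceq_dec (CI (fun t => g (circ r t) * circ r t)%C) 0) as [H|H]; [exact H|].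
  exfalso. exact (Cmult_neq_0 _ _ two_PI_Ci_neq H E).
Qed.

Lemma circ_D (r t : R) : 0 <= r < 1 -> inD (circ r t).
Proof. intros H. unfold inD. rewrite Cmod_circ; lra. Qed.

Lemma cont01_circ_comp (f : C -> C) (r : R) :
  0 <= r < 1 -> cont_D f -> cont01 (fun t => f (circ r t)).
Proof.
  intros Hr Hf t Ht. apply (Kcont_comp f (circ r)).
  - apply Hf, circ_D, Hr.
  - apply circ_cont, Ht.
Qed.

(* When [f' = f1] is itself differentiable, the difference quotient is analytic even at its
   base point, so Cauchy's formula needs no removable singularity. *)
Definition slope (f f1 : C -> C) (z x : C) : C :=
  if Ceq_dec x z then f1 z else ((f x - f z) / (x - z))%C.

Lemma Csub_neq (x z : C) : x <> z -> (x - z)%C <> 0.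
Proof. intros H E. apply H. rewrite <- (Cplus_0_r z), <- E. ring. Qed.

(** Subtract the quadratic Taylor polynomial along the segment: the derivative of the resulting
    curve is [h] times the first-order error of [f1] at [z], hence of size [eps |h|^2]. *)
Lemma Taylor_remainder (f f1 : C -> C) (z l : C) :
  (forall x, inD x -> Cderiv f x (f1 x)) -> inD z -> Cderiv f1 z l ->
  forall eps, 0 < eps -> exists d, 0 < d /\ forall h, Cmod h < d ->
    Cmod (f (z + h)%C - f z - f1 z * h - l * (h * h) / 2) <= eps * (Cmod h * Cmod h).
Proof.
  intros Hf Hz Hl eps He. rewrite Cderiv_eps in Hl. unfold inD in Hz.
  destruct (Hl eps He) as (d & Hd & F).
  exists (Rmin d (1 - Cmod z)); split; [apply Rmin_pos; lra|]. intros h Hh.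
  pose proof (Rlt_le_trans _ _ _ Hh (Rmin_l _ _)) as Hh1.
  pose proof (Rlt_le_trans _ _ _ Hh (Rmin_r _ _)) as Hh2.
  pose proof (Cmod_ge_0 h) as Hh0.
  assert (Hs : forall s, 0 <= s <= 1 -> Cmod (RtoC s * h)%C <= Cmod h)
    by (intros s Hs; rewrite Cmod_mult, Cmod_R, Rabs_right by lra; nra).
  pose (c := fun s : R => (f (z + RtoC s * h)
    + ((- (f1 z * h)) * RtoC s + (- (l * (h * h) / 2)) * (RtoC s * RtoC s)))%C).
  replace (f (z + h)%C - f z - f1 z * h - l * (h * h) / 2)%C with (c 1 - c 0)%C.
  - apply (Kderiv_increment c (fun s => h * (f1 (z + RtoC s * h) - f1 z - l * (RtoC s * h)))%C).
    + intros s Hs1. specialize (Hs s Hs1).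
      assert (K : Kderiv RtoC s (RtoC 1))
        by (apply (Kderiv_RtoC (fun s => s) s 1), (@is_derive_id R_AbsRing)).
      eapply Kderiv_eq.
      * apply Kderiv_plus.
        -- apply (Kderiv_comp f (fun s => z + RtoC s * h)%C);
             [apply Hf | apply Kderiv_segment].
           unfold inD. eapply Rle_lt_trans; [apply Cmod_triangle | lra].
        -- apply Kderiv_plus; (apply Kderiv_mult; [apply Kderiv_const|]).
           ++ exact K.
           ++ apply Kderiv_mult; exact K.
      * cbv beta. field.
    + intros s Hs1. specialize (Hs s Hs1). rewrite Cmod_mult.
      assert (B : Cmod (f1 (z + RtoC s * h)%C - f1 z - l * (RtoC s * h)) <= eps * Cmod h).
      { eapply Rle_trans; [apply F; lra|]. apply Rmult_le_compat_l; lra. }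
      nra.
  - unfold c. replace (z + RtoC 1 * h)%C with (z + h)%C by ring.
    replace (z + RtoC 0 * h)%C with z by ring. field.
Qed.

(** At the base point the second-order expansion gives the derivative [l / 2]. Elsewhere [slope] is
    the plain quotient on the ball of radius [|x - z|], and the quotient rule applies. *)
Lemma slope_analytic (f f1 : C -> C) (z : C) :
  (forall x, inD x -> Cderiv f x (f1 x)) -> analytic_D f1 -> inD z ->
  analytic_D (slope f f1 z).
Proof.
  intros Hf Hf1 Hz x Hx. destruct (Ceq_dec x z) as [->|Hne].
  - destruct (Hf1 z Hz) as [l Hl]. exists (l / 2)%C. apply Cderiv_eps. intros eps He.
    destruct (Taylor_remainder f f1 z l Hf Hz Hl eps He) as (d & Hd & F).
    exists d; split; [exact Hd|]. intros h Hh. specialize (F h Hh).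
    unfold slope. destruct (Ceq_dec z z) as [_|N]; [|congruence].
    destruct (Ceq_dec (z + h) z) as [E|Hh0].
    + assert (h = 0) as -> by (replace h with (z + h - z)%C by ring; rewrite E; ring).
      replace (f1 z - f1 z - l / 2 * 0)%C with (RtoC 0) by ring. rewrite Cmod_0. lra.
    + apply Csub_neq in Hh0. replace (z + h - z)%C with h in * by ring.
      replace ((f (z + h)%C - f z) / h - f1 z - l / 2 * h)%C
        with ((f (z + h)%C - f z - f1 z * h - l * (h * h) / 2) / h)%C by (field; exact Hh0).
      assert (0 < Cmod h) by (apply Cmod_gt_0; exact Hh0).
      rewrite Cmod_div by exact Hh0. apply Rle_div_l; [assumption|].
      replace (eps * Cmod h * Cmod h) with (eps * (Cmod h * Cmod h)) by ring. exact F.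
  - apply Csub_neq in Hne.
    assert (Hpos : 0 < Cmod (x - z)) by (apply Cmod_gt_0; exact Hne).
    eexists. apply (Cderiv_ext_ball (fun x => (f x - f z) * / (x - z))%C _ x _ (Cmod (x - z)));
      [exact Hpos| |].
    + intros h Hh. unfold slope. destruct (Ceq_dec (x + h) z) as [E|_]; [|reflexivity].
      exfalso. rewrite <- E in Hh. replace (x - (x + h))%C with (- h)%C in Hh by ring.
      rewrite Cmod_opp in Hh. lra.
    + apply Cderiv_mult.
      * apply Cderiv_minus; [apply Hf, Hx | apply Cderiv_const].
      * apply Cderiv_inv; [exact Hne|].
        apply Cderiv_minus; [apply Cderiv_id | apply Cderiv_const].
Qed.

(** * Cauchy-type integrals and their derivatives *)

Lemma cont01_inv_sub (c : R -> C) (z : C) :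
  cont01 c -> (forall t, (c t - z)%C <> 0) -> cont01 (fun t => / (c t - z))%C.
Proof.
  intros Hc Hn t Ht. apply (Kcont_comp Cinv (fun t => c t - z)%C).
  - eapply Cderiv_cont, Cderiv_inv_id, Hn.
  - apply (cont01_minus c (fun _ => z)); [exact Hc | apply cont01_const | exact Ht].
Qed.

Lemma cont01_pow (c : R -> C) (n : nat) : cont01 c -> cont01 (fun t => c t ^ n)%C.
Proof.
  intros Hc. induction n as [|n IH].
  - exact (cont01_const 1).
  - apply (cont01_mult c (fun t => c t ^ n)%C); assumption.
Qed.

Lemma cont01_bounded (c : R -> C) :
  cont01 c -> exists t0, 0 <= t0 <= 1 /\ forall t, 0 <= t <= 1 -> Cmod (c t) <= Cmod (c t0).
Proof.
  intros Hc. destruct (continuity_ab_maj (fun t => Cmod (c t)) 0 1) as (t0 & H & Ht0).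
  - lra.
  - intros t Ht. apply continuity_pt_filterlim, continuous_R_eps. intros eps He.
    destruct (proj1 (Kcont_eps c t) (Hc t Ht) eps He) as (d & Hd & F).
    exists d; split; [exact Hd|]. intros h Hh. specialize (F h Hh).
    eapply Rle_lt_trans; [|exact F]. apply Rabs_le.
    pose proof (Cmod_sub_ge (c (t + h)%R) (c t)).
    pose proof (Cmod_sub_ge (c t) (c (t + h)%R)) as H2. rewrite Cmod_sub_sym in H2. lra.
  - exists t0. split; assumption.
Qed.

(** With [n = 1] and [phi t = f (circ r t) * circ r t] this is Cauchy's integral of [f] in the
    variable [t]. An arbitrary continuous [phi] separates differentiation in [z] from any property
    of [f]. *)
Definition Cauchy_kernel (phi : R -> C) (r : R) (n : nat) (z : C) : C :=
  CI (fun t => phi t * (/ (circ r t - z)) ^ n)%C.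

Lemma kernel_cont (phi : R -> C) (r : R) (n : nat) (z : C) :
  cont01 phi -> Cmod z < r -> cont01 (fun t => phi t * (/ (circ r t - z)) ^ n)%C.
Proof.
  intros Hp Hz. apply cont01_mult; [exact Hp|]. apply cont01_pow, cont01_inv_sub.
  - apply circ_cont.
  - intros t. apply circ_neq, Hz.
Qed.

(** Meant for [u = 1 / (x - z)] and [v = 1 / (x - z - h)], which satisfy [v - u = h u v]. The
    constant [M] depends only on [A] and [n], which is the uniformity needed under the integral
    sign. *)
Lemma pow_second_order (A : R) (n : nat) :
  0 <= A -> exists M, 0 <= M /\ forall u v h : C,
    Cmod u <= A -> Cmod v <= A -> (v - u = h * (u * v))%C ->
    Cmod (v ^ n - u ^ n - RtoC (INR n) * h * u ^ S n)%C <= M * (Cmod h * Cmod h).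
Proof.
  intros HA. induction n as [|n (M & HM & IH)].
  - exists 0. split; [lra|]. intros u v h _ _ _. simpl.
    replace (1 - 1 - 0 * h * (u * 1))%C with (RtoC 0) by ring. rewrite Cmod_0. lra.
  - pose proof (pow_le A n HA) as HAn. pose proof (pos_INR n) as Hn.
    exists (A * M + INR n * (A * A ^ n) * (A * A) + A ^ n * (A * A * A)).
    assert (0 <= A * A) by nra. assert (0 <= A * A ^ n) by nra.
    split.
    { repeat apply Rplus_le_le_0_compat; repeat apply Rmult_le_pos; assumption. }
    intros u v h Hu Hv E. specialize (IH u v h Hu Hv E).
    pose proof (Cmod_ge_0 u). pose proof (Cmod_ge_0 v). pose proof (Cmod_ge_0 h).
    assert (Hun : Cmod (u ^ n)%C <= A ^ n)
      by (rewrite Cmod_pow; apply pow_incr; lra).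
    pose proof (Cmod_ge_0 (u ^ n)%C).
    set (e := (v ^ n - u ^ n - RtoC (INR n) * h * u ^ S n)%C) in *.
    rewrite S_INR, RtoC_plus.
    replace (v ^ S n - u ^ S n - (RtoC (INR n) + 1) * h * u ^ S (S n))%C
      with (v * e + RtoC (INR n) * (u * u ^ n) * (u * v) * (h * h)
            + u ^ n * (u * u * v) * (h * h))%C.
    2:{ assert (X : (h * (u * v) - (v - u))%C = 0) by (rewrite E; ring).
        transitivity (v ^ S n - u ^ S n - (RtoC (INR n) + 1) * h * u ^ S (S n)
          + (h * (u * v) - (v - u)) * (u ^ n + RtoC (INR n) * h * (u * u ^ n)
                                       + u ^ n * h * u))%C.
        - unfold e. simpl. ring.
        - rewrite X. ring. }
    assert (B1 : Cmod (v * e)%C <= A * M * (Cmod h * Cmod h)).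
    { rewrite Cmod_mult, Rmult_assoc. apply Rmult_le_compat; try apply Cmod_ge_0; assumption. }
    assert (B2 : Cmod (RtoC (INR n) * (u * u ^ n) * (u * v) * (h * h))%C
                 <= INR n * (A * A ^ n) * (A * A) * (Cmod h * Cmod h)).
    { rewrite !Cmod_mult, Cmod_R, Rabs_right by lra.
      apply Rmult_le_compat_r; [nra|].
      repeat (apply Rmult_le_compat; try assumption; repeat apply Rmult_le_pos;
              try assumption); lra. }
    assert (B3 : Cmod (u ^ n * (u * u * v) * (h * h))%C
                 <= A ^ n * (A * A * A) * (Cmod h * Cmod h)).
    { rewrite !Cmod_mult. apply Rmult_le_compat_r; [nra|].
      repeat (apply Rmult_le_compat; try assumption; repeat apply Rmult_le_pos;
              try assumption); lra. }
    eapply Rle_trans; [apply Cmod_triangle|].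
    eapply Rle_trans; [apply Rplus_le_compat_r, Cmod_triangle|].
    rewrite !Rmult_plus_distr_r. lra.
Qed.

(** Differentiation under the integral by a second-order bound uniform in [t]. Since [q] is half the
    distance from [z] to the circle, for [|h| < q] both [z] and [z + h] stay at distance at least
    [q] from it. *)
Lemma kernel_derive (phi : R -> C) (r : R) (n : nat) (z : C) :
  cont01 phi -> Cmod z < r ->
  Cderiv (Cauchy_kernel phi r n) z (RtoC (INR n) * Cauchy_kernel phi r (S n) z)%C.
Proof.
  intros Hp Hz. set (q := (r - Cmod z) / 2). assert (Hq : 0 < q) by (unfold q; lra).
  destruct (cont01_bounded phi Hp) as (t0 & _ & HB). set (B := Cmod (phi t0)) in *.
  assert (HB0 : 0 <= B) by apply Cmod_ge_0.
  assert (Hiq : 0 < / q) by (apply Rinv_0_lt_compat; exact Hq).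
  destruct (pow_second_order (/ q) n) as (M & HM & T); [lra|].
  apply Cderiv_eps. intros eps He.
  assert (HBM : 0 <= B * M) by (apply Rmult_le_pos; assumption).
  exists (Rmin q (eps / (B * M + 1))); split.
  { apply Rmin_pos; [exact Hq | apply Rdiv_lt_0_compat; lra]. }
  intros h Hh.
  pose proof (Rlt_le_trans _ _ _ Hh (Rmin_l _ _)) as Hh1.
  pose proof (Rlt_le_trans _ _ _ Hh (Rmin_r _ _)) as Hh2.
  assert (Hzh : Cmod (z + h) <= Cmod z + Cmod h) by apply Cmod_triangle.
  assert (Hr : Cmod (z + h) < r) by (unfold q in *; lra).
  assert (Hr0 : 0 <= r) by (pose proof (Cmod_ge_0 z); lra).
  assert (L : forall w t, Cmod w <= Cmod z + q -> Cmod (/ (circ r t - w))%C <= / q).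
  { intros w t Hw. assert (Hwr : Cmod w < r) by (unfold q in *; lra).
    rewrite Cmod_inv by (apply circ_neq, Hwr).
    apply Rinv_le_contravar; [exact Hq|].
    pose proof (Cmod_sub_ge (circ r t) w) as S. rewrite Cmod_circ in S by exact Hr0.
    unfold q in *. lra. }
  unfold Cauchy_kernel.
  pose proof (kernel_cont phi r n (z + h)%C Hp Hr) as K1.
  pose proof (kernel_cont phi r n z Hp Hz) as K2.
  pose proof (kernel_cont phi r (S n) z Hp Hz) as K3.
  replace (RtoC (INR n) * CI (fun t => phi t * (/ (circ r t - z)) ^ S n) * h)%C
    with (CI (fun t => RtoC (INR n) * h * (phi t * (/ (circ r t - z)) ^ S n))%C)
    by (rewrite CI_scal by exact K3; ring).
  rewrite <- CI_minus by assumption.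
  rewrite <- (CI_minus (fun t => phi t * (/ (circ r t - (z + h))) ^ n
                               - phi t * (/ (circ r t - z)) ^ n)%C).
  2:{ apply cont01_minus; assumption. }
  2:{ apply cont01_mult; [apply cont01_const | exact K3]. }
  apply Rle_trans with (B * M * (Cmod h * Cmod h)).
  - apply CI_norm.
    + apply cont01_minus; [apply cont01_minus; assumption|].
      apply cont01_mult; [apply cont01_const | exact K3].
    + intros t Ht. set (u := (/ (circ r t - z))%C). set (v := (/ (circ r t - (z + h)))%C).
      replace (phi t * v ^ n - phi t * u ^ n - RtoC (INR n) * h * (phi t * u ^ S n))%C
        with (phi t * (v ^ n - u ^ n - RtoC (INR n) * h * u ^ S n))%C by ring.
      rewrite Cmod_mult, Rmult_assoc.
      apply Rmult_le_compat; try apply Cmod_ge_0; [apply HB, Ht|].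
      apply T.
      * apply L. lra.
      * apply L. lra.
      * unfold u, v. field. split; apply circ_neq; assumption.
  - pose proof (Cmod_ge_0 h). apply Rlt_div_r in Hh2; [|lra]. nra.
Qed.

Lemma circ_winding (r : R) (z : C) :
  Cmod z < r -> CI (fun t => circ r t * / (circ r t - z))%C = 1.
Proof.
  intros Hz. pose proof (Cmod_ge_0 z) as Hz0.
  set (G := Cauchy_kernel (circ r) r 1).
  assert (E : forall w, CI (fun t => circ r t * / (circ r t - w))%C = G w).
  { intros w. apply CI_ext. intros t _. rewrite Cpow_1_r. reflexivity. }
  assert (D : forall w, Cmod w < r -> Cderiv G w (RtoC 0)).
  { intros w Hw. eapply Cderiv_eq; [apply (kernel_derive (circ r) r 1 w (circ_cont r) Hw)|].
    replace (Cauchy_kernel (circ r) r 2 w) with (RtoC 0); [ring|]. symmetry.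
    unfold Cauchy_kernel.
    rewrite (CI_ext _ (fun t => / ((circ r t - w) * (circ r t - w)) * circ r t)%C).
    - apply (circ_integral_derive (fun x => - (1) * / (x - w))%C
                (fun x => / ((x - w) * (x - w)))%C).
      + intros t _. eapply Cderiv_eq.
        * apply Cderiv_mult; [apply Cderiv_const|].
          apply Cderiv_inv; [apply circ_neq, Hw|].
          apply Cderiv_minus; [apply Cderiv_id | apply Cderiv_const].
        * cbv beta. field. apply circ_neq, Hw.
      + intros t Ht. pose proof (kernel_cont (fun _ => 1) r 2 w (cont01_const _) Hw t Ht) as K.
        cbv beta in K. revert K. apply Kcont_ext. intros s. simpl. field. apply circ_neq, Hw.
    - intros t _. simpl. field. apply circ_neq, Hw. }
  rewrite E.
  assert (Hc : Cmod (G (0 + RtoC 1 * z)%C - G (0 + RtoC 0 * z)%C) <= 0).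
  { apply (Kderiv_increment (fun s => G (0 + RtoC s * z)%C) (fun _ => RtoC 0)).
    - intros s Hs. eapply Kderiv_eq.
      + apply (Kderiv_comp G (fun s => 0 + RtoC s * z)%C); [apply D | apply Kderiv_segment].
        replace (0 + RtoC s * z)%C with (RtoC s * z)%C by ring.
        rewrite Cmod_mult, Cmod_R, Rabs_right by lra. nra.
      + ring.
    - intros s _. rewrite Cmod_0. lra. }
  replace (0 + RtoC 1 * z)%C with z in Hc by ring.
  replace (0 + RtoC 0 * z)%C with (RtoC 0) in Hc by ring.
  assert (H0 : (G z - G 0)%C = 0)
    by (apply Cmod_eq_0, Rle_antisym; [exact Hc | apply Cmod_ge_0]).
  replace (G z) with ((G z - G 0) + G 0)%C by ring. rewrite H0, <- E.
  rewrite (CI_ext _ (fun _ => RtoC 1)).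
  - rewrite CI_const. ring.
  - intros t _. replace (circ r t - 0)%C with (circ r t) by ring. field.
    replace (circ r t) with (circ r t - 0)%C by ring. apply circ_neq. rewrite Cmod_0. lra.
Qed.

(** The slope at [z] has a primitive on the disc, so it integrates to 0 over the circle; splitting
    the quotient leaves [f z] times the winding integral. *)
Lemma Cauchy_formula (f f1 : C -> C) (r : R) (z : C) :
  (forall x, inD x -> Cderiv f x (f1 x)) -> analytic_D f1 -> Cmod z < r -> r < 1 ->
  f z = Cauchy_kernel (fun t => f (circ r t) * circ r t)%C r 1 z.
Proof.
  intros Hf Hf1 Hz Hr. pose proof (Cmod_ge_0 z) as Hz0.
  assert (HzD : inD z) by (unfold inD; lra).
  assert (Hc : cont_D f) by (intros x Hx; eapply Cderiv_cont, Hf, Hx).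
  pose proof (slope_analytic f f1 z Hf Hf1 HzD) as Hg.
  destruct (primitive_D _ Hg) as (G & _ & HG).
  assert (I0 : CI (fun t => slope f f1 z (circ r t) * circ r t)%C = 0).
  { apply (circ_integral_derive G).
    - intros t _. apply HG, circ_D. lra.
    - apply cont01_circ_comp; [lra | apply analytic_cont_D, Hg]. }
  assert (Kc : cont01 (fun t => circ r t * / (circ r t - z))%C).
  { apply cont01_mult; [apply circ_cont|].
    apply cont01_inv_sub; [apply circ_cont | intros t; apply circ_neq, Hz]. }
  assert (Kf : cont01 (fun t => f (circ r t) * circ r t * (/ (circ r t - z)) ^ 1)%C).
  { apply (kernel_cont (fun t => f (circ r t) * circ r t)%C); [|exact Hz].
    apply cont01_mult; [apply cont01_circ_comp; [lra | exact Hc] | apply circ_cont]. }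
  rewrite (CI_ext _ (fun t => f (circ r t) * circ r t * (/ (circ r t - z)) ^ 1
                   - f z * (circ r t * / (circ r t - z)))%C) in I0.
  - rewrite (CI_minus (fun t => f (circ r t) * circ r t * (/ (circ r t - z)) ^ 1)%C) in I0.
    + rewrite CI_scal, circ_winding in I0 by assumption. unfold Cauchy_kernel.
      set (J := CI _) in *.
      replace (f z) with (J - (J - f z * 1))%C by ring. rewrite I0. ring.
    + exact Kf.
    + apply cont01_mult; [apply cont01_const | exact Kc].
  - intros t _. pose proof (circ_neq r t z Hz) as N. unfold slope.
    destruct (Ceq_dec (circ r t) z) as [e|_].
    + exfalso. apply N. rewrite e. ring.
    + rewrite Cpow_1_r. field. exact N.
Qed.

(** * Analyticity of the derivative and the maximum modulus principle *)

Lemma Cderiv_C_derive (f : C -> C) (z : C) :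
  @ex_derive C_AbsRing C_NormedModule f z -> Cderiv f z (C_derive f z).
Proof. intros H. apply C_derive_correct; assumption. Qed.

Lemma ball_in_disc (r : R) (z h : C) : Cmod h < r - Cmod z -> Cmod (z + h) < r.
Proof. intros H. eapply Rle_lt_trans; [apply Cmod_triangle | lra]. Qed.

(** Cauchy's formula cannot yet be applied to [f], but its primitive [F] has the analytic derivative
    [f]. On a disc of radius [r] between [|z|] and 1 this gives [F = G 1], then [f = G 2] and
    [f' = 2 G 3] by differentiating kernels, and [G 3] is differentiable again. *)
Lemma analytic_C_derive (f : C -> C) : analytic_D f -> analytic_D (C_derive f).
Proof.
  intros Hf. destruct (primitive_D f Hf) as (F & _ & HF).
  assert (HFc : cont_D F) by (intros x Hx; eapply Cderiv_cont, HF, Hx).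
  intros z Hz. unfold inD in Hz. pose proof (Cmod_ge_0 z).
  set (r := (1 + Cmod z) / 2). assert (Hr : Cmod z < r < 1) by (unfold r; lra).
  set (G := Cauchy_kernel (fun t => F (circ r t) * circ r t)%C r).
  assert (Hphi : cont01 (fun t => F (circ r t) * circ r t)%C)
    by (apply cont01_mult; [apply cont01_circ_comp; [lra | exact HFc] | apply circ_cont]).
  assert (DG : forall n w, Cmod w < r -> Cderiv (G n) w (RtoC (INR n) * G (S n) w)%C)
    by (intros; apply kernel_derive; assumption).
  assert (E1 : forall w, Cmod w < r -> F w = G 1%nat w)
    by (intros; apply (Cauchy_formula F f); auto; lra).
  assert (E2 : forall w, Cmod w < r -> f w = (RtoC (INR 1) * G 2%nat w)%C).
  { intros w Hw. rewrite <- (is_C_derive_unique F w (f w)) by (apply HF; unfold inD; lra).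
    apply is_C_derive_unique.
    apply (Cderiv_ext_ball (G 1%nat) F w _ (r - Cmod w)); [lra| |apply DG, Hw].
    intros h Hh. symmetry. apply E1, ball_in_disc, Hh. }
  assert (E3 : forall w, Cmod w < r -> C_derive f w = (RtoC (INR 2) * G 3%nat w)%C).
  { intros w Hw. apply is_C_derive_unique.
    apply (Cderiv_ext_ball (G 2%nat) f w _ (r - Cmod w)); [lra| |apply DG, Hw].
    intros h Hh. rewrite E2 by (apply ball_in_disc, Hh). simpl. ring. }
  eexists. apply (Cderiv_ext_ball (fun w => RtoC (INR 2) * G 3%nat w)%C _ z _ (r - Cmod z));
    [lra| |].
  - intros h Hh. symmetry. apply E3, ball_in_disc, Hh.
  - apply Cderiv_mult; [apply Cderiv_const | apply DG; lra].
Qed.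

Lemma analytic_pow (f : C -> C) (n : nat) : analytic_D f -> analytic_D (fun z => f z ^ n)%C.
Proof.
  intros Hf z Hz. destruct (Hf z Hz) as [l Hl].
  induction n as [|n [m Hm]].
  - exists (RtoC 0). exact (Cderiv_const 1 z).
  - eexists. apply (Cderiv_mult f (fun z => f z ^ n)%C); [exact Hl | exact Hm].
Qed.

(* Cauchy's formula for [f^n] gives [|f z|^n <= K M^n] with [K] independent of [n]. *)
Lemma maximum_modulus (f : C -> C) (r M : R) (z : C) :
  analytic_D f -> Cmod z < r -> r < 1 ->
  (forall w, Cmod w = r -> Cmod (f w) <= M) -> Cmod (f z) <= M.
Proof.
  intros Hf Hz Hr HM. pose proof (Cmod_ge_0 z) as Hz0.
  assert (HM0 : 0 <= M).
  { eapply Rle_trans; [apply Cmod_ge_0 | apply (HM (circ r 0)), Cmod_circ; lra]. }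
  set (K := r / (r - Cmod z)).
  assert (B : forall n, Cmod (f z) ^ n <= M ^ n * K).
  { intros n. pose proof (analytic_pow f n Hf) as Hn.
    rewrite <- Cmod_pow.
    assert (D : forall x, inD x -> Cderiv (fun z => f z ^ n)%C x (C_derive (fun z => f z ^ n)%C x))
      by (intros x Hx; apply Cderiv_C_derive, Hn, Hx).
    pose proof (Cauchy_formula (fun z => f z ^ n)%C _ r z D (analytic_C_derive _ Hn) Hz Hr) as E.
    cbv beta in E. rewrite E. unfold Cauchy_kernel. apply CI_norm.
    - apply (kernel_cont (fun t => f (circ r t) ^ n * circ r t)%C); [|exact Hz].
      apply cont01_mult; [|apply circ_cont].
      apply (cont01_circ_comp (fun z => f z ^ n)%C); [lra | apply analytic_cont_D, Hn].
    - intros t _. rewrite Cpow_1_r. rewrite !Cmod_mult, Cmod_pow, Cmod_circ by lra.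
      rewrite Cmod_inv by (apply circ_neq, Hz).
      pose proof (Cmod_sub_ge (circ r t) z) as S. rewrite Cmod_circ in S by lra.
      rewrite Rmult_assoc. apply Rmult_le_compat.
      + apply pow_le, Cmod_ge_0.
      + apply Rmult_le_pos; [lra|]. apply Rlt_le, Rinv_0_lt_compat. lra.
      + apply pow_incr. split; [apply Cmod_ge_0 | apply HM, Cmod_circ; lra].
      + apply Rmult_le_compat_l; [lra|]. apply Rinv_le_contravar; lra. }
  destruct (Rle_lt_dec (Cmod (f z)) M) as [H|H]; [exact H | exfalso].
  destruct (Req_dec M 0) as [->|HM1].
  - specialize (B 1%nat). simpl in B. lra.
  - assert (Q : 1 < Cmod (f z) / M) by (apply Rlt_div_r; lra).
    destruct (Pow_x_infinity (Cmod (f z) / M)) with (b := K + 1) as [N HN].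
    + rewrite Rabs_right; lra.
    + specialize (HN N (le_n N)). specialize (B N).
      assert (P : 0 < M ^ N) by (apply pow_lt; lra).
      rewrite Rabs_right in HN by (apply Rle_ge, pow_le; lra).
      assert (E : (Cmod (f z) / M) ^ N * M ^ N = Cmod (f z) ^ N)
        by (rewrite <- Rpow_mult_distr; f_equal; field; lra).
      nra.
Qed.

(** * The exponential and the inverse hyperbolic sine *)

Lemma Cexp_parts (z : C) :
  Cexp z = (exp (fst z) * cos (snd z), exp (fst z) * sin (snd z)).
Proof.
  unfold Cexp, Re, Im. apply injective_projections; simpl; ring.
Qed.

Lemma Cexp_plus (z w : C) : Cexp (z + w) = (Cexp z * Cexp w)%C.
Proof.
  rewrite !Cexp_parts. apply injective_projections; simpl;
    rewrite exp_plus, ?cos_plus, ?sin_plus; ring.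
Qed.

Lemma Cexp_0 : Cexp 0 = 1.
Proof.
  rewrite Cexp_parts. simpl. rewrite exp_0, cos_0, sin_0.
  apply injective_projections; simpl; ring.
Qed.

Lemma Cmod_Cexp (z : C) : Cmod (Cexp z) = exp (fst z).
Proof.
  unfold Cexp, Re, Im. rewrite Cmod_mult, Cmod_R, Rabs_right by (apply Rle_ge, Rlt_le, exp_pos).
  replace (Cmod _) with 1; [ring|]. unfold Cmod. simpl.
  pose proof (sin2_cos2 (snd z)) as H. unfold Rsqr in H.
  rewrite <- sqrt_1 at 1. f_equal. etransitivity; [symmetry; exact H | ring].
Qed.

(** Real calculus along the ray through [h] is enough: [Kderiv_increment] converts it into estimates
    of [Cexp h - 1] and then of [Cexp h - 1 - h], from which the addition formula gives the complex
    derivative everywhere. *)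
Lemma Kderiv_Cexp_ray (h : C) (s : R) :
  Kderiv (fun s => Cexp (RtoC s * h)) s (h * Cexp (RtoC s * h))%C.
Proof.
  destruct h as [x y]. split.
  - apply (is_derive_ext (fun s => exp (s * x) * cos (s * y))).
    + intros t. rewrite Cexp_parts. simpl. f_equal; f_equal; ring.
    + rewrite Cexp_parts. simpl. auto_derive; [exact I|].
      replace (s * x - 0 * y) with (s * x) by ring.
      replace (s * y + 0 * x) with (s * y) by ring. ring.
  - apply (is_derive_ext (fun s => exp (s * x) * sin (s * y))).
    + intros t. rewrite Cexp_parts. simpl. f_equal; f_equal; ring.
    + rewrite Cexp_parts. simpl. auto_derive; [exact I|].
      replace (s * x - 0 * y) with (s * x) by ring.
      replace (s * y + 0 * x) with (s * y) by ring. ring.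
Qed.

Lemma Cexp_sub_1 (h : C) : Cmod h <= 1 -> Cmod (Cexp h - 1) <= exp 1 * Cmod h.
Proof.
  intros Hh.
  replace (Cexp h - 1)%C with (Cexp (RtoC 1 * h) - Cexp (RtoC 0 * h))%C.
  - apply (Kderiv_increment (fun s => Cexp (RtoC s * h)) (fun s => h * Cexp (RtoC s * h))%C).
    + intros s _. apply Kderiv_Cexp_ray.
    + intros s Hs. rewrite Cmod_mult, Rmult_comm, Cmod_Cexp.
      apply Rmult_le_compat_r; [apply Cmod_ge_0|].
      assert (E : fst (RtoC s * h)%C <= 1).
      { eapply Rle_trans; [apply Rle_abs|]. eapply Rle_trans; [apply fst_le_Cmod|].
        rewrite Cmod_mult, Cmod_R, Rabs_right by lra. pose proof (Cmod_ge_0 h). nra. }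
      destruct E as [E | ->]; [apply Rlt_le, exp_increasing, E | lra].
  - replace (RtoC 1 * h)%C with h by ring. replace (RtoC 0 * h)%C with (RtoC 0) by ring.
    rewrite Cexp_0. reflexivity.
Qed.

Lemma Cexp_derive (z : C) : Cderiv Cexp z (Cexp z).
Proof.
  apply Cderiv_eps. intros eps He. set (m := exp (fst z)).
  assert (Hm : 0 < m) by apply exp_pos. pose proof (exp_pos 1) as He1.
  assert (Hq : 0 < eps / (m * exp 1)) by (apply Rdiv_lt_0_compat; nra).
  exists (Rmin 1 (eps / (m * exp 1))). split; [apply Rmin_pos; lra|]. intros h Hh.
  pose proof (Rlt_le_trans _ _ _ Hh (Rmin_l _ _)) as Hh1.
  pose proof (Rlt_le_trans _ _ _ Hh (Rmin_r _ _)) as Hh2.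
  pose proof (Cmod_ge_0 h) as Hh0.
  rewrite Cexp_plus.
  replace (Cexp z * Cexp h - Cexp z - Cexp z * h)%C
    with (Cexp z * (Cexp h - 1 - h))%C by ring.
  rewrite Cmod_mult, Cmod_Cexp. fold m.
  assert (B : Cmod (Cexp h - 1 - h)%C <= exp 1 * Cmod h * Cmod h).
  { pose (c := fun s => (Cexp (RtoC s * h) + - (1) * (0 + RtoC s * h))%C).
    replace (Cexp h - 1 - h)%C with (c 1 - c 0)%C.
    - apply (Kderiv_increment c (fun s => h * (Cexp (RtoC s * h) - 1))%C).
      + intros s _. eapply Kderiv_eq.
        * apply Kderiv_plus; [apply Kderiv_Cexp_ray|].
          apply Kderiv_mult; [apply Kderiv_const | apply Kderiv_segment].
        * cbv beta. ring.
      + intros s Hs. assert (Hsh : Cmod (RtoC s * h)%C <= Cmod h)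
          by (rewrite Cmod_mult, Cmod_R, Rabs_right by lra; nra).
        rewrite Cmod_mult, Rmult_comm. apply Rmult_le_compat_r; [exact Hh0|].
        eapply Rle_trans; [apply Cexp_sub_1; lra|]. apply Rmult_le_compat_l; lra.
    - unfold c. replace (RtoC 1 * h)%C with h by ring.
      replace (RtoC 0 * h)%C with (RtoC 0) by ring. rewrite Cexp_0. ring. }
  apply Rlt_div_r in Hh2; [|nra].
  apply Rle_trans with (m * (exp 1 * Cmod h * Cmod h)).
  - apply Rmult_le_compat_l; lra.
  - replace (m * (exp 1 * Cmod h * Cmod h)) with (Cmod h * (m * exp 1) * Cmod h) by ring.
    apply Rmult_le_compat_r; lra.
Qed.

(** * Bounds for the inverse hyperbolic sine on the disc *)

Lemma Cmod_sqr (z : C) : Cmod z * Cmod z = fst z * fst z + snd z * snd z.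
Proof.
  unfold Cmod. rewrite sqrt_sqrt; [simpl; ring|].
  simpl. nra.
Qed.

(** From [sinh (x + i y) = sinh x cos y + i cosh x sin y] and [cosh^2 = 1 + sinh^2]. In this form
    both [|sin y|] and [|sinh x|] are visibly at most the modulus. *)
Lemma Cmod_Csinh (z : C) :
  Cmod (Csinh z) * Cmod (Csinh z)
  = sinh (fst z) * sinh (fst z) + sin (snd z) * sin (snd z).
Proof.
  rewrite Cmod_sqr.
  assert (E : Csinh z = (sinh (fst z) * cos (snd z), cosh (fst z) * sin (snd z))).
  { unfold Csinh. rewrite !Cexp_parts. simpl. rewrite cos_neg, sin_neg.
    unfold sinh, cosh. apply injective_projections; simpl; field. }
  rewrite E. simpl.
  pose proof (sin2_cos2 (snd z)) as T. unfold Rsqr in T.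
  assert (H : cosh (fst z) * cosh (fst z) = 1 + sinh (fst z) * sinh (fst z)).
  { unfold cosh, sinh. assert (P : exp (fst z) * exp (- fst z) = 1)
      by (rewrite <- exp_plus, Rplus_opp_r; apply exp_0).
    nra. }
  replace (sinh (fst z) * cos (snd z) * (sinh (fst z) * cos (snd z)) +
    cosh (fst z) * sin (snd z) * (cosh (fst z) * sin (snd z)))
    with (sinh (fst z) * sinh (fst z) * (cos (snd z) * cos (snd z))
          + cosh (fst z) * cosh (fst z) * (sin (snd z) * sin (snd z))) by ring.
  rewrite H.
  replace (cos (snd z) * cos (snd z)) with (1 - sin (snd z) * sin (snd z)) by lra. ring.
Qed.

Lemma sinh_ge_id (x : R) : 0 <= x -> x <= sinh x.
Proof.
  intros Hx.
  destruct (MVT_gen sinh 0 x cosh) as (c & _ & E).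
  - intros y _. apply is_derive_Reals, derivable_pt_lim_sinh.
  - intros y _. apply derivable_continuous_pt. exists (cosh y). apply derivable_pt_lim_sinh.
  - rewrite sinh_0 in E.
    assert (1 <= cosh c).
    { unfold cosh. pose proof (exp_ineq1_le c). pose proof (exp_ineq1_le (- c)). lra. }
    nra.
Qed.

Lemma Rabs_le_sinh (x : R) : Rabs x * Rabs x <= sinh x * sinh x.
Proof.
  unfold Rabs. destruct (Rcase_abs x) as [H|H].
  - assert (sinh x = - sinh (- x)) as -> by (unfold sinh; rewrite Ropp_involutive; lra).
    pose proof (sinh_ge_id (- x)). nra.
  - pose proof (sinh_ge_id x). nra.
Qed.

(** On the lines [Im = PI / 2] and [Im = - PI / 2] the modulus of [sinh] is at least 1, so the image
    of a ray, which starts at [h 0 = 0], cannot meet them; the intermediate value theorem keeps it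
    between. The sign [s] treats both lines at once, and [h 0 = 0] is what singles out the
    branch. *)
Lemma asinh_strip (h : C -> C) (z : C) (s : R) :
  is_asinh_D h -> inD z -> s * s = 1 -> s * snd (h z) < PI / 2.
Proof.
  intros (Ha & H0 & Hs) Hz Hss. pose proof PI_RGT_0.
  pose (y := fun t : R => s * snd (h (0 + RtoC t * z)%C) - PI / 2).
  assert (HD : forall t, 0 <= t <= 1 -> inD (0 + RtoC t * z)%C)
    by (intros; apply ray_D; assumption).
  assert (Hy : forall t, 0 <= t <= 1 -> y t <> 0).
  { intros t Ht E. unfold y in E. specialize (HD t Ht).
    pose proof (Cmod_Csinh (h (0 + RtoC t * z)%C)) as S. rewrite (Hs _ HD) in S.
    unfold inD in HD. pose proof (Cmod_ge_0 (0 + RtoC t * z)).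
    set (v := snd (h (0 + RtoC t * z)%C)) in *. set (u := sinh _) in S.
    assert (V : v = s * (PI / 2)).
    { replace (PI / 2) with (s * v) by lra. rewrite <- Rmult_assoc, Hss. ring. }
    assert (S1 : sin v * sin v = 1).
    { rewrite V. assert (s = 1 \/ s = -1) as [-> | ->] by nra.
      - rewrite Rmult_1_l, sin_PI2. ring.
      - replace (-1 * (PI / 2)) with (- (PI / 2)) by ring. rewrite sin_neg, sin_PI2. ring. }
    nra. }
  replace (h z) with (h (0 + RtoC 1 * z)%C) by (f_equal; ring).
  apply Rnot_le_lt. intros Hle.
  destruct (IVT_interv y 0 1) as (t & Ht & Et).
  - intros t Ht. apply continuity_pt_filterlim.
    assert (K : Kcont (fun t => h (0 + RtoC t * z)%C) t).
    { apply (Kcont_comp h (fun t => 0 + RtoC t * z)%C).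
      - apply (analytic_cont_D h Ha), HD, Ht.
      - eapply Kderiv_cont, Kderiv_segment. }
    apply (@continuous_minus R_UniformSpace R_AbsRing R_NormedModule
             (fun t => s * snd (h (0 + RtoC t * z)%C)) (fun _ => PI / 2));
      [|apply continuous_const].
    apply (@continuous_mult R_UniformSpace R_AbsRing (fun _ => s));
      [apply continuous_const | apply K].
  - lra.
  - unfold y. replace (0 + RtoC 0 * z)%C with (RtoC 0) by ring. rewrite H0. simpl. lra.
  - assert (y 1 <> 0) by (apply Hy; lra). unfold y in *. lra.
  - exact (Hy t Ht Et).
Qed.

(* With [h z = x + i y] one has [sinh |x| < cos y = sin (PI/2 - |y|)],
   whence [|x| + |y| < PI/2]. *)
Lemma asinh_bound (h : C -> C) (z : C) :
  is_asinh_D h -> inD z -> Cmod (h z) <= PI / 2.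
Proof.
  intros Hh Hz. eapply Rle_trans; [apply Cmod_le_sum|].
  pose proof (asinh_strip h z 1 Hh Hz ltac:(lra)) as Y1.
  pose proof (asinh_strip h z (-1) Hh Hz ltac:(lra)) as Y2.
  pose proof (Cmod_Csinh (h z)) as S. destruct Hh as (_ & _ & Hs).
  rewrite (Hs z Hz) in S. unfold inD in Hz. pose proof (Cmod_ge_0 z).
  pose proof (Rabs_le_sinh (fst (h z))) as X.
  set (x := fst (h z)) in *. set (y := snd (h z)) in *.
  set (b := PI / 2 - Rabs y).
  assert (Hb : 0 < b) by (unfold b, Rabs; destruct (Rcase_abs y); lra).
  assert (Hcb : sin b = cos y).
  { unfold b. rewrite sin_shift. unfold Rabs. destruct (Rcase_abs y); [apply cos_neg | reflexivity]. }
  pose proof (sin_lt_x b Hb) as L.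
  assert (Hsb : 0 <= sin b).
  { apply sin_ge_0; [lra|]. unfold b. pose proof (Rabs_pos y). pose proof PI_RGT_0. lra. }
  pose proof (sin2_cos2 y) as T. unfold Rsqr in T. rewrite <- Hcb in T.
  pose proof (Rabs_pos x).
  assert (Rabs x * Rabs x <= sin b * sin b) by nra.
  assert (Rabs x <= sin b) by nra.
  unfold b in *. lra.
Qed.

(** * The differential subordination *)

(** A step to the left, short enough to stay in [[0, t0]], would increase [g] if [l] were negative.
    Looking only to the left covers an interior maximum and one at the end of the radius alike. *)
Lemma left_max_derive (g : R -> R) (t0 l : R) :
  0 < t0 -> (forall t, 0 <= t <= t0 -> g t <= g t0) -> is_derive g t0 l -> 0 <= l.
Proof.
  intros Ht Hg Hd. apply Rnot_lt_le. intros Hl.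
  rewrite is_derive_R_eps in Hd. destruct (Hd (- l / 2)) as (d & Hd0 & F); [lra|].
  set (h := - (Rmin d t0 / 2)).
  assert (Hm : 0 < Rmin d t0) by (apply Rmin_pos; assumption).
  pose proof (Rmin_l d t0). pose proof (Rmin_r d t0).
  assert (Ha : Rabs h = - h) by (apply Rabs_left; unfold h; lra).
  assert (Hh : Rabs h < d) by (rewrite Ha; unfold h; lra).
  specialize (F h Hh). rewrite Ha in F.
  assert (G : g (t0 + h) <= g t0) by (apply Hg; unfold h; lra).
  apply Rabs_le_between in F. assert (h < 0) by (unfold h; lra). nra.
Qed.

(* At a point of [[0, z]] where [|f|] is maximal, the radial derivative of [|f|^2] is
   nonnegative, so the second-order term cannot help to reduce [a1 |f|]. *)
Lemma radial_bound (f f1 g : C -> C) (a1 a2 B : R) (z : C) :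
  0 < a1 -> 0 < a2 ->
  (forall x, inD x -> Cderiv f x (f1 x)) ->
  (forall x, inD x -> g x = (RtoC a1 * f x + RtoC a2 * (x * f1 x))%C) ->
  (forall x, inD x -> Cmod (g x) <= B) ->
  inD z -> a1 * Cmod (f z) <= B.
Proof.
  intros Ha1 Ha2 Hf Hg HB Hz.
  assert (HD : forall t, 0 <= t <= 1 -> inD (0 + RtoC t * z)%C)
    by (intros; apply ray_D; assumption).
  pose (c := fun t : R => f (0 + RtoC t * z)%C).
  pose (dc := fun t : R => (f1 (0 + RtoC t * z) * z)%C).
  assert (Hc : forall t, 0 <= t <= 1 -> Kderiv c t (dc t)).
  { intros t Ht. apply (Kderiv_comp f (fun t => 0 + RtoC t * z)%C);
      [apply Hf, HD, Ht | apply Kderiv_segment]. }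
  destruct (cont01_bounded c) as (t0 & Ht0 & Hmax).
  { intros t Ht. eapply Kderiv_cont, Hc, Ht. }
  assert (Hfz : Cmod (f z) <= Cmod (c t0)).
  { replace (f z) with (c 1); [apply Hmax; lra|]. unfold c. f_equal. ring. }
  apply Rle_trans with (a1 * Cmod (c t0)); [apply Rmult_le_compat_l; lra|].
  set (x0 := (0 + RtoC t0 * z)%C). set (w := g x0).
  assert (E : w = (RtoC a1 * c t0 + RtoC a2 * (RtoC t0 * dc t0))%C).
  { unfold w. rewrite Hg by (apply HD, Ht0). unfold dc, c. fold x0. unfold x0 at 2. ring. }
  assert (Hw : Cmod w <= B) by (apply HB, HD, Ht0).
  (* The factor [t0] comes from [x0 = t0 z]; it settles the case [t0 = 0], where there is no room to
     the left and the derivative has no known sign. *)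
  assert (R0 : 0 <= t0 * (fst (c t0) * fst (dc t0) + snd (c t0) * snd (dc t0))).
  { destruct (Req_dec t0 0) as [->|Hn]; [lra|]. apply Rmult_le_pos; [lra|].
    assert (0 <= 2 * (fst (c t0) * fst (dc t0) + snd (c t0) * snd (dc t0))); [|lra].
    apply (left_max_derive (fun t => Cmod (c t) * Cmod (c t)) t0); [lra| |].
    - intros t Ht. pose proof (Cmod_ge_0 (c t)).
      assert (Cmod (c t) <= Cmod (c t0)) by (apply Hmax; lra). nra.
    - destruct (Hc t0 Ht0) as [H1 H2].
      apply (is_derive_ext (fun t => fst (c t) * fst (c t) + snd (c t) * snd (c t))).
      + intros t. symmetry. apply Cmod_sqr.
      + pose proof (@is_derive_plus _ _ _ _ _ _ _ (is_derive_mult _ _ _ _ _ H1 H1 Rmult_comm)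
                  (is_derive_mult _ _ _ _ _ H2 H2 Rmult_comm)) as H.
        refine (eq_ind _ (is_derive _ t0) H _ _). unfold plus, mult; simpl; ring. }
  assert (S : a1 * (Cmod (c t0) * Cmod (c t0)) <= Cmod w * Cmod (c t0)).
  { apply Rle_trans with (fst (Cconj (c t0) * w)%C).
    - rewrite Cmod_sqr, E. pose proof (Rmult_le_pos a2 _ (Rlt_le _ _ Ha2) R0).
      assert (A : forall u v : C, fst (Cconj u * (RtoC a1 * u + RtoC a2 * (RtoC t0 * v)))%C
        = a1 * (fst u * fst u + snd u * snd u)
          + a2 * (t0 * (fst u * fst v + snd u * snd v)))
        by (intros; simpl; ring).
      rewrite A. lra.
    - eapply Rle_trans; [apply Rle_abs|]. eapply Rle_trans; [apply fst_le_Cmod|].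
      rewrite Cmod_mult, Cmod_conj. lra. }
  pose proof (Cmod_ge_0 (c t0)) as Hc0. pose proof (Cmod_ge_0 w).
  destruct (Req_dec (Cmod (c t0)) 0) as [Z|Z]; [rewrite Z; lra|].
  assert (0 < Cmod (c t0)) by lra.
  apply Rle_trans with (Cmod w); [|exact Hw].
  apply Rmult_le_reg_r with (Cmod (c t0)); [assumption|]. lra.
Qed.

Lemma increment_from_0 (F f : C -> C) (M : R) (z : C) :
  (forall x, inD x -> Cderiv F x (f x)) -> (forall x, inD x -> Cmod (f x) <= M) ->
  inD z -> Cmod (F z - F 0) <= M * Cmod z.
Proof.
  intros HF HM Hz.
  assert (HD : forall t, 0 <= t <= 1 -> inD (0 + RtoC t * z)%C)
    by (intros; apply ray_D; assumption).
  replace (F z - F 0)%C with (F (0 + RtoC 1 * z) - F (0 + RtoC 0 * z))%C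
    by (f_equal; [f_equal; ring | f_equal; f_equal; ring]).
  apply (Kderiv_increment (fun t => F (0 + RtoC t * z)%C) (fun t => f (0 + RtoC t * z) * z)%C).
  - intros t Ht. apply (Kderiv_comp F (fun t => 0 + RtoC t * z)%C);
      [apply HF, HD, Ht | apply Kderiv_segment].
  - intros t Ht. rewrite Cmod_mult. apply Rmult_le_compat_r; [apply Cmod_ge_0|].
    apply HM, HD, Ht.
Qed.

Lemma subord_exp_of_derive_bound (p : C -> C) (k : R) :
  analytic_D p -> p (RtoC 0) = RtoC 1 -> k < 1 / 2 ->
  (forall z, inD z -> Cmod (C_derive p z) <= k) -> subord p Cexp.
Proof.
  intros Hp Hp0 Hk Hd.
  assert (Dp : forall x, inD x -> Cderiv p x (C_derive p x))
    by (intros x Hx; apply Cderiv_C_derive, Hp, Hx).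
  assert (Hk0 : 0 <= k).
  { eapply Rle_trans; [apply Cmod_ge_0 | apply (Hd 0)]. unfold inD. rewrite Cmod_0. lra. }
  assert (Hp1 : forall z, inD z -> 1 - k <= Cmod (p z)).
  { intros z Hz. pose proof (increment_from_0 p _ k z Dp Hd Hz) as I. rewrite Hp0 in I.
    rewrite Cmod_sub_sym in I. pose proof (Cmod_sub_ge 1 (1 - p z)) as T.
    replace (1 - (1 - p z))%C with (p z) in T by ring. rewrite Cmod_1 in T.
    unfold inD in Hz. pose proof (Cmod_ge_0 z). nra. }
  assert (Hpn : forall z, inD z -> p z <> 0)
    by (intros z Hz; apply Cmod_gt_0; specialize (Hp1 z Hz); lra).
  set (L := fun z => (C_derive p z * / p z)%C).
  assert (HL : analytic_D L).
  { intros z Hz. destruct (analytic_C_derive p Hp z Hz) as [l Hl].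
    eexists. apply Cderiv_mult; [exact Hl|]. apply Cderiv_inv; [apply Hpn, Hz | apply Dp, Hz]. }
  assert (BL : forall z, inD z -> Cmod (L z) <= 1).
  { intros z Hz. unfold L. rewrite Cmod_mult, Cmod_inv by (apply Hpn, Hz).
    specialize (Hp1 z Hz). specialize (Hd z Hz).
    (* The quotient is at most [k / (1 - k)], and [k < 1 / 2] makes this at most 1. *)
    apply Rle_div_l; lra. }
  destruct (primitive_D L HL) as (W & W0 & HW).
  assert (BW : forall z, inD z -> Cmod (W z) <= Cmod z).
  { intros z Hz. pose proof (increment_from_0 W L 1 z HW BL Hz) as I. rewrite W0 in I.
    replace (W z - 0)%C with (W z) in I by ring. lra. }
  exists W. split; [|split; [|split]].
  - intros z Hz. eexists. apply HW, Hz.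
  - intros z Hz. unfold inD in *. eapply Rle_lt_trans; [apply BW|]; exact Hz.
  - exact W0.
  - intros z Hz.
    (* Since [W' = p' / p], the function [p e^(-W)] has derivative 0 and keeps its value 1 at the
       origin; multiplying by [e^W] then gives [p = e^W] without a branch of the logarithm. *)
    assert (I : Cmod (p z * Cexp (- (1) * W z) - p 0 * Cexp (- (1) * W 0))%C <= 0 * Cmod z).
    { apply (increment_from_0 (fun z => p z * Cexp (- (1) * W z))%C (fun _ => 0)).
      - intros x Hx. eapply Cderiv_eq.
        + apply Cderiv_mult; [apply Dp, Hx|].
          apply (Cderiv_comp Cexp (fun x => - (1) * W x)%C); [apply Cexp_derive|].
          apply Cderiv_mult; [apply Cderiv_const | apply HW, Hx].
        + unfold L. cbv beta. field. apply Hpn, Hx.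
      - intros x _. rewrite Cmod_0. lra.
      - exact Hz. }
    rewrite Hp0, W0 in I. replace (- (1) * 0)%C with (RtoC 0) in I by ring.
    rewrite Cexp_0 in I.
    assert (Z : (p z * Cexp (- (1) * W z) - 1 * 1)%C = 0)
      by (apply Cmod_eq_0, Rle_antisym; [lra | apply Cmod_ge_0]).
    assert (E : (Cexp (- (1) * W z) * Cexp (W z))%C = 1).
    { rewrite <- Cexp_plus. transitivity (Cexp 0); [f_equal; ring | apply Cexp_0]. }
    transitivity (p z * (Cexp (- (1) * W z) * Cexp (W z)))%C; [rewrite E; ring|].
    transitivity ((p z * Cexp (- (1) * W z) - 1 * 1) * Cexp (W z) + Cexp (W z))%C; [ring|].
    rewrite Z. ring.
Qed.

Theorem theorem4p9 (a1 a2 : R) (asinh p : C -> C) :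
  0 < a1 -> 0 < a2 -> 2 * (a1 - a2) >= PI * exp 1 ->
  is_asinh_D asinh ->
  analytic_D p -> p (RtoC 0) = RtoC 1 ->
  subord
    (fun z => (RtoC 1 + RtoC a1 * z * C_derive p z
               + RtoC a2 * (z * z) * C_derive (C_derive p) z)%C)
    (fun z => (RtoC 1 + asinh z)%C) ->
  subord p Cexp.
Proof.
  intros Ha1 Ha2 Ha Hs Hp Hp0 (w & _ & Hw & _ & E).
  pose proof PI_RGT_0 as HPI.
  pose proof (analytic_C_derive p Hp) as Hp1.
  pose proof (analytic_C_derive _ Hp1) as Hp2.
  set (p1 := C_derive p) in *. set (p2 := C_derive p1) in *.
  set (chi := fun z => (RtoC a1 * p1 z + RtoC a2 * (z * p2 z))%C).
  assert (Hchi : analytic_D chi).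
  { intros z Hz. destruct (Hp1 z Hz) as [l1 H1]. destruct (Hp2 z Hz) as [l2 H2].
    eexists. apply Cderiv_plus; (apply Cderiv_mult; [apply Cderiv_const|]).
    - exact H1.
    - apply Cderiv_mult; [apply Cderiv_id | exact H2]. }
  assert (B : forall z, inD z -> Cmod z * Cmod (chi z) <= PI / 2).
  { intros z Hz. rewrite <- Cmod_mult.
    replace (z * chi z)%C with (asinh (w z)).
    - apply asinh_bound; [exact Hs | apply Hw, Hz].
    - specialize (E z Hz). cbv beta in E. unfold chi.
      transitivity ((1 + asinh (w z)) - 1)%C; [ring|]. rewrite <- E. ring. }
  assert (Bchi : forall z, inD z -> Cmod (chi z) <= PI / 2).
  { intros z Hz. unfold inD in Hz. pose proof (Cmod_ge_0 z).
    apply Rnot_lt_le. intros Hlt. set (m := Cmod (chi z)) in *.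
    assert (Hq : PI / 2 / m < 1) by (apply Rlt_div_l; lra).
    (* In place of the limit [r -> 1]: if [m > PI / 2], some radius [r < 1] exceeds both [|z|] and
       [(PI / 2) / m], and the maximum principle on that circle gives [m <= (PI / 2) / r < m]. *)
    set (r := (Rmax (Cmod z) (PI / 2 / m) + 1) / 2).
    pose proof (Rmax_l (Cmod z) (PI / 2 / m)). pose proof (Rmax_r (Cmod z) (PI / 2 / m)).
    assert (Hm : Rmax (Cmod z) (PI / 2 / m) < 1) by (apply Rmax_lub_lt; assumption).
    assert (Hr : PI / 2 / m < r) by (unfold r; lra).
    assert (M : m <= PI / 2 / r).
    { apply (maximum_modulus chi r); [exact Hchi | unfold r; lra | unfold r; lra|].
      intros x Hx. apply Rle_div_r; [unfold r; lra|].
      rewrite <- Hx, Rmult_comm. apply B. unfold inD. rewrite Hx. unfold r. lra. }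
    apply Rle_div_r in M; [|unfold r; lra].
    apply (proj1 (Rlt_div_l (PI / 2) r m ltac:(lra))) in Hr. lra. }
  apply (subord_exp_of_derive_bound p (PI / 2 / a1)); [exact Hp | exact Hp0| |].
  - apply Rlt_div_l; [exact Ha1|].
    (* The hypothesis gives [2 a1 > PI e], and [e > 2] turns this into [a1 > PI], which is the
       required bound on the constant [PI / 2 / a1]. *)
    assert (2 < exp 1) by (pose proof (exp_ineq1 1); lra). nra.
  - intros z Hz. apply Rle_div_r; [exact Ha1|]. rewrite Rmult_comm.
    apply (radial_bound p1 p2 chi a1 a2); auto.
    intros x Hx. apply Cderiv_C_derive, Hp1, Hx.
Qed.
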